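(* Let $A$ be a finite set of complex variables, let $\alpha^*,\beta^*\in A$ and $A'=A\setminus\{\alpha^*,\beta^*\}$, and regard $J^*(A)$ as a meromorphic function of the elements of $A$. Then $J^*(A)$ has a simple pole at $\alpha^*=-\beta^*$ with $$\operatorname{Res}_{\alpha^*=-\beta^*}J^*(A)=J^*(A'\cup\{\beta^*\})+J^*(A'\cup\{-\beta^*\})+2N\,J^*(A'),$$ and the poles cancel at $\alpha^*=0$: $\operatorname{Res}_{\alpha^*=0}J^*(A)=0$.
   Context: $z(x)=\frac1{1-e^{-x}}$; $Y(A)=\prod_{\alpha\in A}z(2\alpha)$; $Z(A,B)=\prod_{\alpha\in A,\beta\in B}z(\alpha+\beta)$; $Z^\dagger$ is $Z$ with factors of zero argument omitted; $D^-=\{-\delta:\delta\in D\}$. For a finite set $A$ and positive integer $N$, $J^*(A)=\sum_{D\subseteq A}e^{-2N\sum_{\delta\in D}\delta}(-1)^{|D|}\sqrt{\frac{Z(D,D)Z(D^-,D^-)Y(D)}{Y(D^-)Z^{\dagger}(D^-,D)^2}}\sum_{A\setminus D=W_1\cup\cdots\cup W_R}\prod_{r}H_D(W_r)$, the inner sum over set partitions of $A\setminus D$ into nonempty blocks of size at most 2 (equal to 1 if empty), with $H_D(\{\alpha\})=\sum_{\delta\in D}\left(\frac{z'}{z}(\alpha-\delta)-\frac{z'}{z}(\alpha+\delta)\right)-\frac{z'}{z}(2\alpha)$ and $H_D(\{\alpha,\hat\alpha\})=\left(\frac{z'}{z}\right)'(\alpha+\hat\alpha)$. *)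

(* Defs.v *)
From HB Require Import structures.
From mathcomp Require Import all_boot all_order all_algebra.
From mathcomp Require Import all_classical all_reals all_analysis.
From mathcomp Require Import complex.

Set Implicit Arguments.
Unset Strict Implicit.
Unset Printing Implicit Defensive.

Import Order.TTheory GRing.Theory Num.Theory.
Import numFieldNormedType.Exports.

Local Open Scope ring_scope.
Local Open Scope classical_set_scope.

(* The sort of a numClosedFieldType carries its topology and is a normed module
   over itself, so derivatives of functions C -> C below are complex ones. *)
Definition C (R : realType) : numClosedFieldType := R[i]%C.

Section ComplexFunctions.
Variable R : realType.
Local Notation C := (C R).

Definition cexp (x : C) : C :=
  Complex (expR (complex.Re x) * cos (complex.Im x))
          (expR (complex.Re x) * sin (complex.Im x)).

Definition z (x : C) : C := (1 - cexp (- x))^-1.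

(* z'/z *)
Definition dlogz (x : C) : C := derive1 z x / z x.

(* (z'/z)' *)
Definition ddlogz (x : C) : C := derive1 dlogz x.

(* [p.[1 / (w - c)]] is the principal part at [c] of the Laurent expansion of
   [f]; then [p`_1] is the residue of [f] at [c], [p = r *: 'X] says that [f] has
   at most a simple pole with residue [r], and [p = 0] that the singularity is
   removable. *)
Definition principal_part (f : C -> C) (c : C) (p : {poly C}) : Prop :=
  p`_0 = 0 /\
  exists g : C -> C,
    (\forall w \near c, derivable g w 1) /\
    (\forall w \near c^', f w = g w + p.[(w - c)^-1]).

End ComplexFunctions.

(* A finite set of complex variables is a set of indices [A : {set 'I_n}]; the
   value of the variable [i] under the valuation [a : 'rV_n] is [a 0 i]. *)
Section Jstar.
Variables (R : realType) (n : nat).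
Local Notation C := (C R).
Implicit Types (a u v : 'rV[C]_n) (A D E W : {set 'I_n}).

Definition update a (i : 'I_n) (w : C) : 'rV[C]_n :=
  \row_k (if k == i then w else a 0 k).

(* [cexp x = 1] iff x lies in 2 pi i Z, the set of poles of z: off the
   hyperplanes excluded here every term of J^* is finite, and the radicand below
   is finite and nonzero. *)
Definition generic D a : Prop :=
  forall k l, k \in D -> l \in D ->
    cexp (a 0 k + a 0 l) != 1 /\ (k != l -> cexp (a 0 k - a 0 l) != 1).

Definition Y D u : C := \prod_(i in D) z (2 * u 0 i).

Definition Z D u E v : C := \prod_(i in D) \prod_(j in E) z (u 0 i + v 0 j).

Definition Zdag D u E v : C :=
  \prod_(i in D) \prod_(j in E | u 0 i + v 0 j != 0) z (u 0 i + v 0 j).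

(* The set D^- is represented by the indices D under the valuation [- a]. *)
Definition radicand D a : C :=
  (Z D a D a * Z D (- a) D (- a) * Y D a) /
  (Y D (- a) * Zdag D (- a) D a ^+ 2).

(* The radicand is positive when the elements of D are distinct positive reals
   ([0 < x] in C says that x is real and positive), where the square root is the
   positive one; elsewhere it is the continuation of that function to the
   connected set [generic D]. *)
Definition is_sqrt_branch D (s : 'rV[C]_n -> C) : Prop :=
  [/\ forall a, generic D a -> {for a, continuous s},
      forall a, generic D a -> s a ^+ 2 = radicand D a
    & forall a, generic D a -> (forall i, i \in D -> 0 < a 0 i) -> 0 < s a].

Definition sqrt_radicand D : 'rV[C]_n -> C :=
  xget (fun=> 0) [set s | is_sqrt_branch D s].

(* [W] is a block of size 1 or 2. In the first case the outer sum has a single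
   term; in the second the argument of [ddlogz] is the sum of the two elements. *)
Definition H D W a : C :=
  if #|W| == 1%N then
    \sum_(k in W)
      (\sum_(d in D) (dlogz (a 0 k - a 0 d) - dlogz (a 0 k + a 0 d))
       - dlogz (2 * a 0 k))
  else ddlogz (\sum_(k in W) a 0 k).

Definition Jstar (N : nat) A a : C :=
  \sum_(D : {set 'I_n} | D \subset A)
    cexp (- (2 * N)%:R * \sum_(d in D) a 0 d) * (-1) ^+ #|D| *
    sqrt_radicand D a *
    \sum_(P : {set {set 'I_n}} |
            finset.partition P (A :\: D) && [forall W in P, (#|W| <= 2)%N])
      \prod_(W in P) H D W a.

(* J^*(A' u {beta}) + J^*(A' u {- beta}) + 2N J^*(A'), with beta the j-th
   variable *)
Definition Jstar_residue (N : nat) A' (j : 'I_n) a : C :=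
  Jstar N (j |: A') a + Jstar N (j |: A') (update a j (- a 0 j))
  + (2 * N)%:R * Jstar N A' a.

End Jstar.

(* Main.v *)
(* With q(x) = z(x) z(-x), the identity z(x) + z(-x) = 1 gives z'/z(x) = z(-x) and
   (z'/z)'(x) = - q(x).  On the connected set where the radicand is finite and nonzero, its
   square root is the product of z(2 delta) over D times the product of
   q(delta + eps) / q(delta - eps) over unordered pairs, so J^* is an explicit rational
   expression in values of z.

   Sum first over the part D of the subset that lies in A'.  Near alpha^* = - beta^* each
   D contributes four terms.  The terms with both or neither of alpha^*, beta^* in the subset
   have double poles, q(alpha + beta) times opposite values; as q is even, their sum has a
   simple pole whose residue is a logarithmic derivative, and this supplies the term with 2N
   and the parts of J^*(A' u {+-beta^*}) in which +-beta^* is not in the subset.  The two mixed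
   terms have simple poles and supply the remaining parts.  At alpha^* = 0, and likewise at
   alpha^* = beta^*, simple poles cancel in pairs.

   The residue is not identically zero by induction on A': as a function of beta^*, its
   residue at beta^* = - gamma is the same expression for A' \ {gamma}, because J^* is regular
   at equal arguments.  For A' empty it is positive at beta^* = 1. *)

(* [principal_part] asks for a regular part that is differentiable at the pole itself, so every
   cancellation needs an explicit holomorphic remainder. All remainders go back to one function, the
   entire cubic Taylor remainder of exp: it makes (1 - exp (- x)) / x holomorphic with value 1 at 0,
   hence x z(x) as well, and a pole of [z] or [q] becomes a power of the variable times such a germ.

   The square root in the definition is only characterised by continuity, its square and its sign at
   positive points. To identify it with the explicit product, a generic point is joined to a
   positive one inside the generic set. A segment may cross the excluded hyperplanes; but they meet
   the complex line through the two points in countably many places, while there are uncountably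
   many arcs with disjoint interiors. *)
Require Import Defs.
From mathcomp Require Import all_boot all_order all_algebra.
From mathcomp Require Import all_classical all_reals all_analysis.
From mathcomp Require Import complex.
From mathcomp Require Import ring lra.
Set Implicit Arguments.
Unset Strict Implicit.
Unset Printing Implicit Defensive.
Import Order.TTheory GRing.Theory Num.Theory.
Import numFieldNormedType.Exports.
Local Open Scope ring_scope.
Local Open Scope classical_set_scope.

(** * The complex exponential *)
Section ComplexExponential.
Variable R : realType.
Local Notation C := (C R).
Implicit Types (x y w : C) (t : R).

Lemma complexP x y : complex.Re x = complex.Re y -> complex.Im x = complex.Im y -> x = y.
Proof. by case: x y => [a b] [c d] /= -> ->. Qed.

Lemma cexpD x y : cexp (x + y) = cexp x * cexp y.
Proof.
case: x y => [a b] [c d]; rewrite /cexp /= expRD cosD sinD.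
by apply: complexP => /=; ring.
Qed.

Lemma cexp0 : cexp 0 = 1 :> C.
Proof. by apply: complexP; rewrite /= expR0 ?cos0 ?sin0 mul1r. Qed.

Lemma cexp_neq0 x : cexp x != 0.
Proof.
apply/negP => /eqP x0; have := cexpD x (- x).
by rewrite subrr cexp0 x0 mul0r => /eqP; rewrite oner_eq0.
Qed.

Lemma cexpN x : cexp (- x) = (cexp x)^-1.
Proof.
by apply: (mulIf (cexp_neq0 x)); rewrite -cexpD addNr cexp0 mulVf ?cexp_neq0.
Qed.

Lemma cexpN_eq1 x : (cexp (- x) == 1) = (cexp x == 1).
Proof. by rewrite cexpN invr_eq1. Qed.

Definition texp m x : C := \sum_(k < m) (k`!%:R)^-1 * x ^+ k.

Definition rexp m x : C := cexp x - texp m x.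

Local Notation toC := (real_complex R).

Lemma ReZ t w : complex.Re (toC t * w) = t * complex.Re w.
Proof. by case: w => a b /=; rewrite mul0r subr0. Qed.

Lemma ReB x y : complex.Re (x - y) = complex.Re x - complex.Re y.
Proof. by case: x y => [a b] [c d]. Qed.

(** Real parts along the segment from 0 to [x] bring the Taylor remainder within reach of the real
    mean value theorem. The weight [w] absorbs the factor [x] produced by each differentiation. *)
Lemma is_derive_Re_texp m w x t :
  is_derive t 1 (fun s => complex.Re (w * texp m.+1 (toC s * x)))
    (complex.Re (w * x * texp m (toC t * x))).
Proof.
elim: m => [|m IH].
  rewrite [X in is_derive _ _ X _](_ : _ = cst (complex.Re w)); last first.
    by apply/funext => s; rewrite /texp big_ord1 expr0 fact0 invr1 !mulr1.
  by rewrite /texp big_ord0 mulr0; exact: is_derive_cst.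
pose c := complex.Re (w * ((m.+1)`!%:R^-1 * x ^+ m.+1)).
rewrite [X in is_derive _ _ X _](_ : _ =
  (fun s => complex.Re (w * texp m.+1 (toC s * x))) + (fun s => c *: s ^+ m.+1)); last first.
  apply/funext => s; rewrite [RHS]/(_ + _)/=.
  rewrite {1}/texp big_ord_recr/= -/(texp _ _) mulrDr raddfD /=; congr (_ + _).
  rewrite /c /GRing.scale/= [RHS]mulrC -ReZ exprMn -rmorphXn/=; congr complex.Re; ring.
have dX : is_derive t (1 : R) (fun s : R => c *: s ^+ m.+1) (c *: (m.+1%:R * t ^+ m)).
  apply: is_deriveZ; apply: DeriveDef; first exact: exprn_derivable.
  by rewrite exp_derive /GRing.scale/= mulr1.
apply: (is_derive_eq (is_deriveD IH dX)).
rewrite [in RHS]/texp big_ord_recr/= -/(texp _ _) [in RHS]mulrDr.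
rewrite raddfD/=; congr (_ + _).
rewrite /c /GRing.scale/= mulrC -ReZ; congr complex.Re.
rewrite exprMn rmorphM rmorphXn/= rmorph_nat factS natrM exprS.
field.
by rewrite nat1r !pnatr_eq0 -lt0n fact_gt0.
Qed.

Lemma is_derive_Re_rexp m w x t :
  is_derive t 1 (fun s => complex.Re (w * rexp m.+1 (toC s * x)))
    (complex.Re (w * x * rexp m (toC t * x))).
Proof.
rewrite [X in is_derive _ _ X _](_ : _ = (fun s => complex.Re (w * cexp (toC s * x))) -
    (fun s => complex.Re (w * texp m.+1 (toC s * x)))); last first.
  by apply/funext => s; rewrite /rexp mulrBr ReB.
rewrite /rexp mulrBr ReB.
apply: is_deriveB; last exact: is_derive_Re_texp.
case: w => p q; case: x => a b.
rewrite [X in is_derive _ _ X _](_ : _ = fun s : R => expR (s * a) *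
   (p * cos (s * b) - q * sin (s * b))); last first.
  by apply/funext => s; rewrite /cexp /= !mul0r !subr0 !addr0; ring.
apply: is_derive_eq.
rewrite /GRing.scale/= !mul0r !subr0 !addr0; ring.
Qed.

(** Induction by the mean value theorem: along the segment, the remainder of order [m.+1] has the
    remainder of order [m] as derivative, up to the factor [x]. The constant e bounds the
    exponential on the unit disc. *)
Lemma Re_rexp_le m w x t : `|x| <= 1 -> 0 <= t <= 1 ->
  toC `|complex.Re (w * rexp m (toC t * x))| <= toC (expR 1) * `|w| * `|x| ^+ m.
Proof.
move=> x1; elim: m w t => [|m IH] w t /andP[t0 t1].
  rewrite /rexp /texp big_ord0 subr0 expr0 mulr1.
  apply: le_trans (normc_ge_Re _) _; rewrite normrM mulrC ler_wpM2r//.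
  have -> : `|cexp (toC t * x)| = toC (expR (complex.Re (toC t * x))).
    rewrite normc_def /= !exprMn -mulrDr cos2Dsin2 mulr1 sqrtr_sqr ger0_norm//.
  rewrite lecR ler_expR ReZ.
  have : `|complex.Re x| <= 1.
    by rewrite -lecR (le_trans (normc_ge_Re _)).
  rewrite ler_norml => /andP[_ h].
  by rewrite (le_trans (ler_wpM2l t0 h))// mulr1.
pose f s := complex.Re (w * rexp m.+1 (toC s * x)).
have dft (s : R) : is_derive s 1 f (complex.Re (w * x * rexp m (toC s * x))).
  exact: is_derive_Re_rexp.
have [s] : exists2 s, s \in `[0, t]%R &
    f t - f 0 = complex.Re (w * x * rexp m (toC s * x)) * (t - 0).
  apply: MVT_segment => //; apply: continuous_subspaceT => s.
  exact/differentiable_continuous/derivable1_diffP.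
rewrite in_itv/= => /andP[s0 st].
have -> : f 0 = 0.
  rewrite /f rmorph0 mul0r /rexp /texp cexp0 big_ord_recl/= expr0 fact0 invr1 mulr1.
  by rewrite big1 ?addr0 ?subrr ?mulr0// => k _; rewrite expr0n/= mulr0.
rewrite !subr0 /f => ->; rewrite normrM rmorphM/=.
have /(IH (w * x)) : 0 <= s <= 1 by rewrite s0 (le_trans st t1).
rewrite normrM exprS (ger0_norm t0) => h.
apply: le_trans (_ : _ <= toC `|complex.Re (w * x * rexp m (toC s * x))| * 1) _.
  by rewrite ler_wpM2l ?lecR// ler0c.
by rewrite mulr1 (le_trans h)// !mulrA.
Qed.

Lemma rexp_le m x : `|x| <= 1 -> `|rexp m x| <= toC (expR 1) * `|x| ^+ m.
Proof.
move=> x1; set F := rexp m x.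
(* With the conjugate of [F] as weight, the real part is the square of the modulus, and one factor
   of the modulus cancels. *)
have := @Re_rexp_le m (F^*)%C x 1 x1; rewrite ler01 lexx rmorph1 mul1r -/F => /(_ isT).
have FF : (F^*)%C * F = `|F| ^+ 2 by rewrite sqr_normc mulrC.
rewrite FF; have /RRe_real e : `|F| ^+ 2 \is Num.real by rewrite realX// normr_real.
have /complex_realP[r rE] := normr_real F.
rewrite rE -rmorphXn /= ger0_norm ?sqr_ge0// normcJ rmorphXn -rE.
have [->|F0] := eqVneq `|F| 0.
  by rewrite mulr_ge0 ?exprn_ge0// ler0c expR_ge0.
rewrite -[complex_real_complex_def__canonical__GRing_RMorphism R r]rE expr2 mulrAC ler_pM2r//.
by rewrite lt_neqAle eq_sym F0 normr_ge0.
Qed.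

Lemma is_derive_quadratic (f : C -> C) c l (M : C) :
  (forall h, `|h| <= 1 -> `|f (h + c) - f c - l * h| <= M * `|h| ^+ 2) ->
  is_derive c 1 f l.
Proof.
move=> fM.
suff fl : (fun h : C => h^-1 *: (f (h *: (1 : C) + c) - f c)) @ 0^' --> l.
  by apply: DeriveDef; [exact: cvgP fl|exact: cvg_lim fl].
(* [M] is a complex number; the case h = 1 of the hypothesis shows that it is real and
   nonnegative. *)
have M0 : 0 <= M.
  have := fM 1; rewrite normr1 lexx expr1n mulr1 => /(_ isT).
  by rewrite mulr1; apply: le_trans.
apply/cvgrPdist_le => /= e e0.
near=> h.
have h0 : h != 0 by near: h; exact: (@nbhs_dnbhs_neq C).
have h1 : `|h| <= 1 by near: h; exact: (@dnbhs0_le C C).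
have h2 : `|h| <= e / (M + 1).
  by near: h; apply: (@dnbhs0_le C C); rewrite divr_gt0// ltr_wpDl.
rewrite distrC; have -> : h^-1 *: (f (h *: (1 : C) + c) - f c) - l = h^-1 * (f (h + c) - f c -
  l * h).
  by rewrite /GRing.scale/= mulr1 [in RHS]mulrBr [l * h]mulrC mulKf.
rewrite normrM normfV ler_pdivrMl ?normr_gt0//.
apply: le_trans (fM _ h1) _; rewrite expr2 mulrCA ler_wpM2l//.
rewrite -[leRHS](divfK (lt0r_neq0 (_ : 0 < M + 1))) ?ltr_wpDl// mulrC.
by apply: ler_pM => //; rewrite lerDl.
Unshelve. all: by end_near.
Qed.

Lemma is_derive_cexp (c : C) : is_derive c 1 (@cexp R) (cexp c).
Proof.
apply: (@is_derive_quadratic _ _ _ (`|cexp c| * toC (expR 1))) => h h1.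
have -> : cexp (h + c) - cexp c - cexp c * h = cexp c * rexp 2 h.
  rewrite cexpD /rexp /texp !big_ord_recl big_ord0 /= !factS fact0 /=.
  by rewrite /bump/= !mul1n invr1 expr0 expr1; ring.
by rewrite normrM -mulrA ler_wpM2l// rexp_le.
Qed.

(* The value at [0] makes this function entire. *)
Definition cexp3 x : C := if x == 0 then 6^-1 else rexp 3 x / x ^+ 3.

Lemma cexp_cubic x : cexp x = 1 + x + x ^+ 2 / 2 + x ^+ 3 * cexp3 x.
Proof.
rewrite /cexp3; case: eqVneq => [->|x0].
  by rewrite cexp0 !expr0n/= !mul0r !addr0.
rewrite mulrCA divff ?expf_neq0// mulr1 /rexp /texp !big_ord_recl big_ord0 /= !factS fact0 /=.
rewrite /bump/= !mul1n invr1 expr0 expr1 muln1; ring.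
Qed.

Lemma derivable_cexp3 c : derivable cexp3 c 1.
Proof.
have [->|c0] := eqVneq c 0.
  (* 24 = 4!, the next Taylor coefficient; what is left after the linear term is the remainder of
     order 5 over h^3, of size h^2. *)
  suff [] : is_derive (0 : C) 1 cexp3 (24^-1) by [].
  apply: (@is_derive_quadratic _ _ _ (toC (expR 1))) => h h1.
  rewrite addr0 /cexp3 eqxx; case: eqVneq => [->|h0].
    by rewrite subrr mulr0 subrr normr0 expr0n/= mulr0.
  have -> : rexp 3 h / h ^+ 3 - 6^-1 - 24^-1 * h = rexp 5 h / h ^+ 3.
    rewrite /rexp /texp !big_ord_recl !big_ord0 /= !factS fact0 /=.
    rewrite /bump/= !mul1n invr1 expr0 expr1 !muln1 !addr0.
    set e := cexp h; field. exact: h0.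
  rewrite normrM normfV normrX ler_pdivrMr ?exprn_gt0 ?normr_gt0//.
  by rewrite -mulrA -exprD rexp_le.
have : derivable (fun x => rexp 3 x * (x ^+ 3)^-1) c 1.
  apply: derivableM; last first.
    by apply: derivableV; [rewrite expf_neq0|exact: exprn_derivable].
  apply: derivableB; first by have [] := is_derive_cexp c.
  rewrite (_ : texp 3 = fun x => 1 + x + 2^-1 * x ^+ 2); last first.
    apply/funext => x; rewrite /texp !big_ord_recl big_ord0 /= !factS fact0.
    by rewrite /bump/= !mul1n invr1 expr0 expr1 muln1; ring.
  apply: derivableD; first by apply: derivableD; [exact: derivable_cst|exact: derivable_id].
  by apply: derivableM; [exact: derivable_cst|exact: exprn_derivable].
apply: near_eq_derivable.
near=> x; rewrite /cexp3 ifF//; apply/negbTE.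
by near: x; apply: (cvgr_neq0 c) => //; exact: cvg_id.
Unshelve. all: by end_near.
Qed.

End ComplexExponential.

(** * Holomorphic germs and the function z *)

Section Jets.
Variable R : realType.
Local Notation C := (C R).
Local Notation z := (@z R).
Local Notation cexp := (@cexp R).
Implicit Types (c w k s d x : C) (f g : C -> C).

Definition holo c f := \forall w \near c, derivable f w 1.

(* Order one suffices: the poles of J^* are at most double, and [q] is even, so a
   residue involves at most the first derivative of a regular cofactor. *)
Definition jet c f a0 a1 := exists2 g, holo c g &
  \forall w \near c, f w = a0 + a1 * (w - c) + (w - c) ^+ 2 * g w.

Lemma nearC c (P : C -> Prop) : (forall w, P w) -> \forall w \near c, P w.
Proof. exact: (@nearW _ (nbhs c)). Qed.

Lemma near_neq0 c f : {for c, continuous f} -> f c != 0 -> \forall w \near c, f w != 0.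
Proof. exact: (@cvgr_neq0 _ _ _ (nbhs c)). Qed.

Lemma holo_cst c k : holo c (fun=> k).
Proof. by apply: nearC => w; exact: derivable_cst. Qed.

Lemma holo_id c : holo c id.
Proof. by apply: nearC => w; exact: derivable_id. Qed.

Lemma holoD c f g : holo c f -> holo c g -> holo c (fun w => f w + g w).
Proof. by apply: filterS2 => w; exact: derivableD. Qed.

Lemma holoM c f g : holo c f -> holo c g -> holo c (fun w => f w * g w).
Proof. by apply: filterS2 => w; exact: derivableM. Qed.

Lemma holoZ c k f : holo c f -> holo c (fun w => k * f w).
Proof. exact/holoM/holo_cst. Qed.

Lemma holo_sub c : holo c (fun w => w - c).
Proof. exact: holoD (holo_id c) (holo_cst c (- c)). Qed.

Lemma holoV c f : holo c f -> (\forall w \near c, f w != 0) -> holo c (fun w => (f w)^-1).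
Proof. by apply: filterS2 => w fw f0; exact: derivableV. Qed.

Lemma holo_continuous c f : holo c f -> {for c, continuous f}.
Proof.
move=> /nbhs_singleton df.
exact/differentiable_continuous/derivable1_diffP.
Qed.

Lemma holo_near_eq c f g : (\forall w \near c, f w = g w) -> holo c f -> holo c g.
Proof.
move=> /near_join fg; move: fg; apply: filterS2 => w fg; exact: near_eq_derivable.
Qed.

Lemma jet_near_eq c f g a0 a1 :
  (\forall w \near c, f w = g w) -> jet c f a0 a1 -> jet c g a0 a1.
Proof. by move=> fg [h hh E]; exists h => //; move: fg E; apply: filterS2 => w ->. Qed.

Lemma jet_holo c f a0 a1 : jet c f a0 a1 -> holo c f.
Proof.
move=> [g hg fE].
apply: (@holo_near_eq _ (fun w => a0 + a1 * (w - c) + (w - c) ^+ 2 * g w)).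
  by move: fE; apply: filterS => w ->.
have hx := holo_sub c.
exact: holoD (holoD (holo_cst c a0) (holoZ a1 hx)) (holoM (holoM hx hx) hg).
Qed.

Lemma jet_value c f a0 a1 : jet c f a0 a1 -> f c = a0.
Proof.
by move=> [g _ /nbhs_singleton ->]; rewrite subrr expr0n/= mulr0 mul0r !addr0.
Qed.

Lemma jet_neq0 c f a0 a1 : jet c f a0 a1 -> a0 != 0 -> \forall w \near c, f w != 0.
Proof.
move=> jf a00; have /holo_continuous fc := jet_holo jf.
by apply: near_neq0 => //; rewrite (jet_value jf).
Qed.

Lemma jet_cst c k : jet c (fun=> k) k 0.
Proof.
exists (fun=> 0); first exact: holo_cst.
by apply: nearC => w; rewrite mul0r mulr0 !addr0.
Qed.

Lemma jetD c f g a0 a1 b0 b1 : jet c f a0 a1 -> jet c g b0 b1 ->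
  jet c (fun w => f w + g w) (a0 + b0) (a1 + b1).
Proof.
move=> [u hu fE] [v hv gE]; exists (fun w => u w + v w); first exact: holoD.
by move: fE gE; apply: filterS2 => w -> ->; ring.
Qed.

Lemma jetM c f g a0 a1 b0 b1 : jet c f a0 a1 -> jet c g b0 b1 ->
  jet c (fun w => f w * g w) (a0 * b0) (a0 * b1 + a1 * b0).
Proof.
move=> jf [v hv gE]; have hf := jet_holo jf; case: jf => u hu fE.
have hx := holo_sub c.
exists (fun w => a1 * b1 + b1 * (w - c) * u w + b0 * u w + f w * v w).
  exact: holoD (holoD (holoD (holo_cst c (a1 * b1)) (holoM (holoZ b1 hx) hu)) (holoZ b0 hu))
    (holoM hf hv).
by move: fE gE; apply: filterS2 => w -> ->; ring.
Qed.

Lemma jetZ c f k a0 a1 : jet c f a0 a1 -> jet c (fun w => k * f w) (k * a0) (k * a1).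
Proof.
by move=> jf; have := jetM (jet_cst c k) jf; rewrite mul0r addr0.
Qed.

Lemma jetN c f a0 a1 : jet c f a0 a1 -> jet c (fun w => - f w) (- a0) (- a1).
Proof.
move=> /(jetZ (-1)); rewrite !mulN1r; apply: jet_near_eq.
by apply: nearC => w; rewrite mulN1r.
Qed.

Lemma jetB c f g a0 a1 b0 b1 : jet c f a0 a1 -> jet c g b0 b1 ->
  jet c (fun w => f w - g w) (a0 - b0) (a1 - b1).
Proof. by move=> jf /jetN; exact: jetD. Qed.

Lemma jetV c f a0 a1 : jet c f a0 a1 -> a0 != 0 ->
  jet c (fun w => (f w)^-1) a0^-1 (- a1 / a0 ^+ 2).
Proof.
move=> jf a00; have hf := jet_holo jf; have f0 := jet_neq0 jf a00.
case: jf => u hu fE.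
have hx := holo_sub c.
(* Found by subtracting the first-order part from 1 / f: over the denominator a0^2 f the numerator
   is divisible by (w - c)^2. *)
exists (fun w => (a1 ^+ 2 - a0 * u w + a1 * (w - c) * u w) * (a0 ^+ 2)^-1 * (f w)^-1).
  have h : holo c (fun w => - (a0 * u w)).
    by move: (holoZ (- a0) hu); apply: holo_near_eq; apply: nearC => w; rewrite mulNr.
  exact: holoM (holoM (holoD (holoD (holo_cst c (a1 ^+ 2)) h) (holoM (holoZ a1 hx) hu))
    (holo_cst c (a0 ^+ 2)^-1)) (holoV hf f0).
move: fE f0; apply: filterS2 => w fE f0.
have {}f0 : a0 + a1 * (w - c) + (w - c) ^+ 2 * u w != 0 by rewrite -fE.
rewrite fE; field; apply/andP; split=> //.
Qed.

Lemma jet_sum (I : finType) (P : pred I) c (F : I -> C -> C) (a b : I -> C) :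
  (forall i, P i -> jet c (F i) (a i) (b i)) ->
  jet c (fun w => \sum_(i | P i) F i w) (\sum_(i | P i) a i) (\sum_(i | P i) b i).
Proof.
move=> jF; rewrite [X in jet _ X _ _](_ : _ = \sum_(i | P i) F i); last first.
  by apply/funext => w; rewrite fct_sumE.
by elim/big_rec3: _ => [|i x y G Pi IH]; [exact: jet_cst|exact: (jetD (jF i Pi) IH)].
Qed.

(** Normalising the values to 1 turns the product rule into a plain sum. This applies at alpha = -
    beta because the factors can be grouped so that each has value 1 there. *)
Lemma jet_prod1 (I : finType) (P : pred I) c (F : I -> C -> C) (b : I -> C) :
  (forall i, P i -> jet c (F i) 1 (b i)) ->
  jet c (fun w => \prod_(i | P i) F i w) 1 (\sum_(i | P i) b i).
Proof.
move=> jF; rewrite [X in jet _ X _ _](_ : _ = \prod_(i | P i) F i); last first.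
  by apply/funext => w; rewrite fct_prodE.
elim/big_rec2: _ => [|i x G Pi IH]; first exact: jet_cst.
by have := jetM (jF i Pi) IH; rewrite !mulr1 mul1r addrC.
Qed.

Lemma jet_affine c s d : jet c (fun w => s * w + d) (s * c + d) s.
Proof.
exists (fun=> 0); first exact: holo_cst.
by apply: nearC => w; ring.
Qed.

Lemma holo_comp_affine c s d f : holo (s * c + d) f -> holo c (fun w => f (s * w + d)).
Proof.
have /holo_continuous hc := jet_holo (jet_affine c s d).
move=> /hc; rewrite nbhs_simpl /=.
apply: (@filterS _ (nbhs c) (nbhs_filter c)) => w dfw; apply/derivable1_diffP.
apply: (@differentiable_comp _ _ _ _ (fun w => s * w + d) f).
  by apply/derivable1_diffP; have /nbhs_singleton := jet_holo (jet_affine w s d).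
exact/derivable1_diffP.
Qed.

Lemma jet_cexp c s d : jet c (fun w => cexp (s * w + d))
  (cexp (s * c + d)) (s * cexp (s * c + d)).
Proof.
pose E := cexp (s * c + d).
exists (fun w => E * s ^+ 2 * (2^-1 + (s * w + - (s * c)) * cexp3 (s * w + - (s * c)))).
  have h3 : holo c (fun w => cexp3 (s * w + - (s * c))).
    by apply: (@holo_comp_affine _ _ _ (@cexp3 R)); apply: nearC; exact: derivable_cexp3.
  exact: holoZ _ (holoD (holo_cst c 2^-1) (holoM (jet_holo (jet_affine c s (- (s * c)))) h3)).
apply: nearC => w.
have -> : s * w + d = s * c + d + (s * w - s * c) by ring.
rewrite cexpD (cexp_cubic (s * w - s * c)) -/E; ring.
Qed.

Lemma jet_eq c f a0 a1 b0 b1 : jet c f a0 a1 -> a0 = b0 -> a1 = b1 -> jet c f b0 b1.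
Proof. by move=> + <- <-. Qed.

(** This is -1 / (4 sinh^2 (x / 2)), even with a double pole at 0. *)
Definition q x : C := z x * z (- x).

Lemma cexpN_neq1 x : cexp x != 1 -> cexp (- x) != 1.
Proof. by rewrite cexpN_eq1. Qed.

Lemma zN x : cexp x != 1 -> z (- x) = 1 - z x.
Proof.
move=> x1; rewrite /Defs.z opprK cexpN.
have e0 := cexp_neq0 x; move: x1 e0; set e := cexp x => e1 e0.
by field; rewrite ?subr_eq0 ?(eq_sym 1) ?e0 ?e1.
Qed.

Lemma z_neq0 x : cexp x != 1 -> z x != 0.
Proof. by move=> x1; rewrite /Defs.z invr_eq0 subr_eq0 eq_sym cexpN_eq1. Qed.

Lemma q_neq0 x : cexp x != 1 -> q x != 0.
Proof. move=> x1; have x1' : cexp (- x) != 1 by rewrite cexpN_eq1.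
exact: mulf_neq0 (z_neq0 x1) (z_neq0 x1'). Qed.

Lemma qN x : q (- x) = q x.
Proof. by rewrite /q opprK mulrC. Qed.

(** [z] solves the logistic equation z' = z (1 - z), and 1 - z(x) = z(-x). *)
Lemma jet_z c s d : cexp (s * c + d) != 1 ->
  jet c (fun w => z (s * w + d)) (z (s * c + d)) (s * q (s * c + d)).
Proof.
move=> E1; have E1' : 1 - cexp (- s * c + - d) != 0.
  by rewrite mulNr -opprD subr_eq0 eq_sym cexpN_eq1.
have := jetV (jetB (jet_cst c 1) (jet_cexp c (- s) (- d))) E1'.
move=> jz; have sE w : - s * w + - d = - (s * w + d) by ring.
apply: (jet_near_eq (f := fun w => (1 - cexp (- s * w + - d))^-1)).
  by apply: nearC => w; rewrite sE.
apply: (jet_eq jz); rewrite sE //.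
rewrite /q zN// /Defs.z cexpN; move: E1; have := cexp_neq0 (s * c + d).
set e := cexp _ => e0 e1; field.
by rewrite e0 subr_eq0 e1.
Qed.

(* [z 0 = 0^-1 = 0] is a junk value, hence the case distinction. *)
Definition xz x : C := if x == 0 then 1 else x * z x.

Lemma zE x : x != 0 -> z x = xz x / x.
Proof. by move=> x0; rewrite /xz (negbTE x0) mulrAC divff// mul1r. Qed.

(** exp w - 1 is w times a continuous function with value 1 at 0, so its zero at 0 is isolated. *)
Lemma near_cexp_neq1 : \forall w \near (0 : C), w != 0 -> cexp w != 1.
Proof.
have : \forall w \near (0 : C), 1 + w / 2 + w ^+ 2 * cexp3 w != 0.
  apply: (@jet_neq0 0 _ 1 2^-1); last exact: oner_neq0.
  exists (@cexp3 R); first by apply: nearC; exact: derivable_cexp3.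
  by apply: nearC => w; ring.
apply: filterS => w w0 w1; rewrite cexp_cubic -subr_eq0.
have -> : 1 + w + w ^+ 2 / 2 + w ^+ 3 * cexp3 w - 1 = w * (1 + w / 2 + w ^+ 2 * cexp3 w) by ring.
by rewrite mulf_neq0.
Qed.

Lemma jet_xz c s : jet c (fun w => xz (s * (w - c))) 1 (s / 2).
Proof.
(* [g y] is (1 - exp (- y)) / y with the singularity at 0 removed, so [xz] is its inverse. *)
pose g y : C := 1 + - y / 2 + y ^+ 2 * cexp3 (- y).
have jg : jet c (fun w => g (s * (w - c))) 1 (- s / 2).
  exists (fun w => s ^+ 2 * cexp3 (- s * w + s * c)).
    apply: holoZ; apply: (@holo_comp_affine _ _ _ (@cexp3 R)).
    by apply: nearC; exact: derivable_cexp3.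
  apply: nearC => w; rewrite /g.
  have -> : - (s * (w - c)) = - s * w + s * c by ring.
  ring.
have xzE y : y != 0 -> xz y = (g y)^-1.
  move=> y0; rewrite /xz (negbTE y0) /Defs.z cexp_cubic.
  have -> : 1 - (1 + - y + (- y) ^+ 2 / 2 + (- y) ^+ 3 * cexp3 (- y)) = y * g y by rewrite /g;
    ring.
  by rewrite invfM mulrA divff// mul1r.
have := jetV jg (oner_neq0 _); rewrite invr1 expr1n divr1 mulNr opprK.
apply: jet_near_eq; apply: nearC => w.
have [->|wc] := eqVneq (s * (w - c)) 0; last by rewrite xzE.
by rewrite /xz eqxx /g oppr0 mul0r expr0n/= mul0r !addr0 invr1.
Qed.

Lemma jet_is_derive c f a0 a1 : jet c f a0 a1 -> is_derive c 1 f a1.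
Proof.
move=> [g /nbhs_singleton/derivableP dg fE].
have dx : is_derive c 1 (fun w => w - c) 1.
  exact: is_derive_eq (is_deriveB (is_derive_id c 1) (is_derive_cst c c 1)) (subr0 1).
have := is_deriveD (is_deriveD (is_derive_cst a0 c 1) (is_deriveZ a1 dx))
  (is_deriveM (is_deriveM dx dx) dg).
move/(is_derive_eq (df := a1)); rewrite /GRing.scale/= !subrr => h.
apply: (near_eq_is_derive _ (h _)); last by rewrite !fctE subrr; ring.
by move: fE; apply: filterS => w ->; rewrite expr2.
Qed.

Lemma jet_derive1 c f a0 a1 : jet c f a0 a1 -> derive1 f c = a1.
Proof. by move=> /jet_is_derive[_ df]; rewrite derive1E. Qed.

Lemma dlogzE x : cexp x != 1 -> dlogz x = z (- x).
Proof.
move=> x1; have := @jet_z x 1 0; rewrite mul1r addr0 => /(_ x1) jz.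
rewrite /dlogz (@jet_derive1 _ _ (z x) (q x)); last first.
  rewrite -[q x]mul1r; apply: jet_near_eq jz.
  by apply: nearC => w; rewrite mul1r addr0.
by rewrite /q mulrAC divff ?mul1r// z_neq0.
Qed.

Lemma near_cexp_affine_neq1 c s d : cexp (s * c + d) != 1 ->
  \forall w \near c, cexp (s * w + d) != 1.
Proof.
move=> E1; have := jetB (jet_cexp c s d) (jet_cst c 1).
move=> /jet_neq0; rewrite subr_eq0 => /(_ E1).
by apply: filterS => w; rewrite subr_eq0.
Qed.

Lemma ddlogzE x : cexp x != 1 -> ddlogz x = - q x.
Proof.
move=> x1; have Nx1 : cexp (- 1 * x + 0) != 1 by rewrite mulN1r addr0 cexpN_eq1.
rewrite /ddlogz; apply: (@jet_derive1 _ _ (z (- x))).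
have := jet_z Nx1; rewrite !mulN1r addr0 qN; apply: jet_near_eq.
have := @near_cexp_affine_neq1 x 1 0; rewrite mul1r addr0 => /(_ x1).
by apply: filterS => w; rewrite mul1r mulN1r !addr0 => /dlogzE.
Qed.

End Jets.

(** * Sums over partitions into blocks of size at most 2 *)

Local Close Scope classical_set_scope.

Section MatchingSums.
Variables (I : finType) (K : comNzRingType).
Implicit Types (E S W : {set I}) (P : {set {set I}}).

(** Partitions are classified by the block [W] of [x]; removing that block leaves an arbitrary
    partition of the rest. *)
Lemma partition_sum_rec (c : {set I} -> K) E x : x \in E ->
  \sum_(P | finset.partition P E) \prod_(W in P) c W =
  \sum_(W : {set I} | (W \subset E) && (x \in W))
    c W * \sum_(P | finset.partition P (E :\: W)) \prod_(V in P) c V.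
Proof.
move=> xE.
rewrite (partition_big (fun P : {set {set I}} => finset.pblock P x)
  (fun W : {set I} => (W \subset E) && (x \in W))) /=; last first.
  move=> P PE; have xP : x \in finset.cover P by rewrite (cover_partition PE).
  by rewrite mem_pblock xP (partitionS PE) ?pblock_mem.
apply: eq_bigr => W /andP[WE xW].
rewrite (reindex_onto (fun P => W |: P) (fun P => P :\ W)) /=; last first.
  move=> P /andP[PE /eqP <-]; rewrite finset.setD1K// pblock_mem//.
  by rewrite (cover_partition PE).
rewrite big_distrr /=.
have WP P : finset.partition P (E :\: W) -> W \notin P.
  move=> PE; apply/negP => WP; have /fintype.subsetP/(_ x xW) := partitionS PE WP.
  by rewrite inE xW.
apply: eq_big => P.
  apply/idP/idP => [/andP[/andP[PE /eqP bW] /eqP WPW]|PE].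
    have := partitionD1 PE (_ : W \in W |: P).
    by rewrite WPW setU11; apply.
  have WPE : finset.partition (W |: P) E.
    have := partitionU1 PE (_ : W != finset.set0).
    have -> : W :|: E :\: W = E.
      apply/setP => y; rewrite !inE; case: (boolP (y \in W)) => //=.
      by move=> /(fintype.subsetP WE) ->.
    apply.
      by apply/set0Pn; exists x.
    rewrite finset.disjoints_subset; apply/fintype.subsetP => y yW.
    by rewrite !inE yW.
  rewrite WPE (def_pblock (partition_trivIset WPE) (setU11 _ _) xW) eqxx /=.
  by rewrite finset.setU1K// WP.
move=> /andP[/andP[PE /eqP bW] /eqP WPW].
have WnP : W \notin P by rewrite -WPW !inE eqxx.
by rewrite big_setU1.
Qed.

Definition match_sum (h : I -> K) (g : {set I} -> K) E : K :=
  \sum_(P | finset.partition P E && [forall W in P, (#|W| <= 2)%N])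
    \prod_(W in P) (if #|W| == 1%N then \sum_(k in W) h k else g W).

(** Giving weight zero to large blocks moves the size condition from the index set into the weight,
    so that the recursion for all partitions applies. *)
Lemma match_sumE h g E : match_sum h g E = \sum_(P | finset.partition P E)
  \prod_(W in P) (if (#|W| <= 2)%N then
     if #|W| == 1%N then \sum_(k in W) h k else g W else 0).
Proof.
rewrite /match_sum big_mkcondr /=; apply: eq_bigr => P PE.
case: ifP => [/forallP WP|/negbT]; first by apply: eq_bigr => W /(implyP (WP W)) ->.
rewrite negb_forall => /existsP[W]; rewrite negb_imply => /andP[WP /negbTE W2].
by rewrite (bigD1 W) //= W2 mul0r.
Qed.

Lemma match_sum0 h g : match_sum h g finset.set0 = 1.
Proof.
rewrite match_sumE (eq_bigl (pred1 finset.set0)) => [|P]; last by rewrite partition_set0.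
by rewrite big_pred1_eq big_set0.
Qed.

(** Either [x] is alone or it is paired with some [k]. Later arguments expand the sum through this
    recursion and do not return to partitions. *)
Lemma match_sumU1 h g S x : x \notin S -> match_sum h g (x |: S) =
  h x * match_sum h g S + \sum_(k in S) g [set x; k] * match_sum h g (S :\ k).
Proof.
move=> xS; rewrite match_sumE (partition_sum_rec _ (setU11 x S)).
rewrite (bigID (fun W : {set I} => (#|W| <= 2)%N)) /= [X in _ + X]big1 ?addr0; last first.
  by move=> W /andP[_ /negbTE ->]; rewrite mul0r.
rewrite (bigD1 [set x]) /=; last by rewrite finset.sub1set cards1 set11 setU11.
rewrite cards1 /= big_set1 finset.setU1K// -match_sumE; congr (_ + _).
(* The inverse map picks the partner of [x] in [W]; its default would be returned only for the block
   [[set x]], which has been split off. *)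
rewrite (reindex_onto (fun k => [set x; k]) (fun W => odflt x [pick k in W :\ x])) /=; last first.
  move=> W /andP[/andP[/andP[WE xW] W2] Wx].
  case: pickP => [k|Wk] /=; last first.
    case/negP: Wx; apply/eqP/setP => k; have := Wk k; rewrite !inE => Wk'.
    by case: eqVneq Wk' => [-> //|] /= _ ->.
  rewrite !inE => /andP[kx kW]; apply/eqP; rewrite eqEcard.
  rewrite cards2 eq_sym kx W2 andbT.
  by apply/fintype.subsetP => y; rewrite !inE => /orP[] /eqP ->.
apply: eq_big => k.
  have [->|kx] := eqVneq k x.
    by rewrite (negbTE xS) finset.setUid eqxx /= andbF.
  have -> : [set x; k] :\ x = [set k].
    by apply/setP => y; rewrite !inE; case: eqVneq => //= ->; rewrite eq_sym (negbTE kx).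
  have -> : odflt x [pick k0 in [set k]] = k.
    by case: pickP => [y|/(_ k)]; rewrite !inE ?eqxx // => /eqP.
  rewrite eqxx andbT cards2 eq_sym kx /= !inE eqxx andbT /=.
  rewrite finset.subUset !finset.sub1set !inE eqxx (negbTE kx) /= andbT.
  case: (boolP (k \in S)) => //= kS.
  apply/eqP => /setP /(_ k); by rewrite !inE eqxx orbT (negbTE kx).
move=> /andP[/andP[/andP[/andP[kS _] W2] Wx] _].
have kx : k != x by apply: contraNneq Wx => ->; rewrite finset.setUid.
rewrite W2 cards2 (eq_sym x) kx /= -match_sumE; congr (_ * match_sum _ _ _).
apply/setP => y; rewrite !inE; case: eqVneq => [->|yx] //=.
by rewrite (negbTE xS) andbF.
Qed.

Lemma eq_match_sum h h' g g' E : {in E, h =1 h'} ->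
  {in E &, forall k l, k != l -> g [set k; l] = g' [set k; l]} -> match_sum h g E = match_sum
    h' g' E.
Proof.
move=> hh gg; apply: eq_bigr => P /andP[PE /forallP P2].
apply: eq_bigr => W WP; have /fintype.subsetP WE := partitionS PE WP.
have := implyP (P2 W) WP; have := partition_neq0 PE WP; rewrite -card_gt0.
case: eqP => [_ _ _|W1 W0 W2]; first by apply: eq_bigr => k /WE /hh.
have W2' : #|W| == 2%N by move: W1 W0 W2; case: #|W| => [|[|[]]].
have /cards2P[k [l [kl Wkl]]] := W2'.
by rewrite Wkl; apply: gg kl; apply: WE; rewrite Wkl !inE eqxx ?orbT.
Qed.

End MatchingSums.

Section SubsetSums.
Variables (I : finType) (K : nmodType).
Implicit Types (D B : {set I}).

Lemma big_subsetU1 (F : {set I} -> K) i B : i \notin B ->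
  \sum_(D : {set I} | D \subset i |: B) F D =
  \sum_(D : {set I} | D \subset B) (F D + F (i |: D)).
Proof.
move=> iB; rewrite big_split /= (bigID (fun D : {set I} => i \in D)) /= addrC.
congr (_ + _).
  apply: eq_bigl => D; apply/andP/idP => [[DiB iD]|DB].
    by rewrite -(finset.setU1K iB) subsetD1 DiB iD.
  by rewrite (fintype.subset_trans DB) ?subsetU1//; split=> //; apply: contra iB; exact:
    (fintype.subsetP DB).
rewrite (reindex_onto (fun D => i |: D) (fun D => D :\ i)) /=; last first.
  by move=> D /andP[_]; exact: finset.setD1K.
apply: eq_bigl => D; rewrite setU11 andbT.
apply/andP/idP => [[DB /eqP <-]|DB]; last first.
  by rewrite finset.setUS ?finset.setU1K//; apply: contra iB; exact: (fintype.subsetP DB).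
by rewrite -(finset.setU1K iB) finset.setSD.
Qed.

End SubsetSums.

Section JetMatchingSums.
Variables (R : realType) (I : finType).
Local Notation C := (C R).

(** The sum is affine in each [h k], with coefficient the sum over [S :\ k]; the pair weights [g] do
    not depend on the variable. *)
Lemma jet_match_sum (c : C) (h : I -> C -> C) (h0 h1 : I -> C) g (S : {set I}) :
  (forall k, k \in S -> jet c (h k) (h0 k) (h1 k)) ->
  jet c (fun w => match_sum (fun k => h k w) g S) (match_sum h0 g S)
    (\sum_(k in S) h1 k * match_sum h0 g (S :\ k)).
Proof.
have [m] := ubnP #|S|; elim: m S => // m IH S Sm jh.
have [->|[x xS]] := set_0Vmem S.
  rewrite match_sum0 big_set0; apply: jet_near_eq (jet_cst c 1).
  by apply: nearC => w; rewrite match_sum0.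
pose T := S :\ x; have xT : x \notin T by rewrite !inE eqxx.
have ST : S = x |: T by rewrite finset.setD1K.
have Tm : (#|T| < m)%N by move: Sm; rewrite ST cardsU1 xT.
have jT k : k \in T -> jet c (h k) (h0 k) (h1 k).
  by rewrite inE => /andP[_]; exact: jh.
have TDm k : k \in T -> (#|T :\ k| < m)%N.
  by move=> kT; apply: leq_ltn_trans Tm; rewrite subset_leq_card// subD1set.
have jTD k : k \in T -> forall l, l \in T :\ k -> jet c (h l) (h0 l) (h1 l).
  by move=> kT l; rewrite inE => /andP[_]; exact: jT.
have := jetD (jetM (jh x xS) (IH T Tm jT)) (jet_sum (P := mem T)
  (fun k kT => jetZ (g [set x; k]) (IH _ (TDm k kT) (jTD k kT)))).
rewrite -!match_sumU1// -ST => jS.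
apply: jet_eq (jet_near_eq _ jS) _ _ => //.
  by apply: nearC => w; rewrite [in RHS]ST match_sumU1.
rewrite [in RHS]ST [RHS]big_setU1//= -[in X in _ = h1 x * match_sum _ _ X + _]ST.
rewrite -/T [X in X + _]addrC -addrA; congr (_ + _).
(* The derivative of the left side of the recursion is expanded at [x] too; the two double sums over
   [k] and [l] then agree after an exchange of order. *)
have E l : l \in T -> h1 l * match_sum h0 g ((x |: T) :\ l) =
    h0 x * (h1 l * match_sum h0 g (T :\ l)) +
    \sum_(k in T | k != l) g [set x; k] * (h1 l * match_sum h0 g (T :\ k :\ l)).
  move=> lT; have xl : x != l by apply: contraNneq xT => ->.
  have -> : (x |: T) :\ l = x |: (T :\ l).
    apply/setP => y; rewrite !inE; case: (eqVneq y x) => [->|] //=; by rewrite xl.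
  rewrite match_sumU1; last by rewrite inE (negbTE xT) andbF.
  rewrite mulrDr mulrCA; congr (_ + _); rewrite big_distrr /=.
  apply: eq_big => [k|k _]; first by rewrite finset.in_setD1 andbC.
  have -> : T :\ l :\ k = T :\ k :\ l by apply/setP => y; rewrite !finset.in_setD1 andbCA.
  by rewrite mulrCA.
rewrite [RHS](eq_bigr _ E) big_split /= -big_distrr; congr (_ + _).
rewrite [RHS](exchange_big_dep (mem T)) /=; last by move=> l k _ /andP[].
apply: eq_bigr => k kT; rewrite -!big_distrr /=; congr (_ * _).
by apply: eq_bigl => l; rewrite finset.in_setD1 kT andbC eq_sym.
Qed.

End JetMatchingSums.

Local Open Scope classical_set_scope.

(** * The branch of the square root *)

Section AvoidingPaths.
Variable R : realType.
Local Notation C := (C R).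
Local Notation toC := (real_complex R).

Lemma periodicz (f : R -> R) T : periodic f T -> forall (m : int) a, f (a + T *~ m) = f a.
Proof.
move=> fT [m|m] a; first exact: periodicn.
by rewrite -[in RHS](subrK (T *+ m.+1) a) periodicn// NegzE mulrNz.
Qed.

Lemma cexp_eq1 (x : C) : cexp x = 1 -> exists m : int, x = Complex 0 (pi *+ 2 *~ m).
Proof.
case: x => a b x1; have [ecos] := (congr1 (@complex.Re R) x1, congr1 (@complex.Im R) x1).
rewrite /= in ecos * => /eqP; rewrite mulf_eq0 gt_eqF ?expR_gt0//= => /eqP sinb.
have cosb : cos b = 1.
  have : `|cos b| = 1 by exact: sin0cos1.
  have : 0 < cos b by rewrite -(pmulr_rgt0 _ (expR_gt0 a)) ecos.
  by move=> /gtr0_norm ->.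
have a0 : a = 0.
  by apply: expR_inj; rewrite expR0 -ecos cosb mulr1.
(* Let [y] in [0, 2 pi) be the reduction of [b]. From cos y = 1 the double-angle formula gives sin
   (y / 2) = 0, and sin is positive on (0, pi), so y = 0. *)
rewrite a0; exists (Num.floor (b / (pi *+ 2))); congr Complex.
set m := Num.floor _; set T : R := pi *+ 2.
have T0 : 0 < T by rewrite mulrn_wgt0// pi_gt0.
pose y := b - T *~ m.
have cosy : cos y = 1 by rewrite -(periodicz (@cosD2pi R) m) subrK.
have y0 : 0 <= y.
  rewrite subr_ge0 -mulrzr mulrC -ler_pdivlMr// floor_le//.
have yT : y < T.
  rewrite ltrBlDr -[X in X + _]mulr1z -mulrzDr -mulrzr mulrC -ltr_pdivrMr//.
  by rewrite addrC floorD1_gt.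
have : sin (y / 2) = 0.
  have := cos_mulr2n (y / 2); rewrite -[_ *+ 2]mulr_natr divfK// cosy cos2sin2.
  move=> h; apply/eqP; rewrite -(sqrf_eq0 (sin _)); apply/eqP; lra.
move: y0; rewrite le_eqVlt => /orP[/eqP y0 _|y0 siny].
  by apply/eqP; rewrite -subr_eq0 -/y -y0.
have /sin_gt0_pi : 0 < y / 2 < pi.
  by rewrite divr_gt0//= ltr_pdivrMr// mulr_natr.
by rewrite siny ltxx.
Qed.

(** Otherwise the unit interval would be countable, hence of Lebesgue measure zero. *)
Lemma avoid_countable (T : countType) (f : T -> R) : exists c, forall t, f t != c.
Proof.
apply: contrapT => /forallNP h.
have fT : `[0, 1]%classic `<=` range f.
  move=> c _; apply: contrapT => nc; apply: (h c) => t; apply/eqP => ftc.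
  by apply: nc; exists t.
have : lebesgue_measure (`[0, 1]%classic : set R) = 0%E.
  apply: countable_lebesgue_measure0; apply: sub_countable (subset_card_le fT) _.
  by apply: sub_countable (card_image_le _ _) _; exact: countableP.
rewrite lebesgue_measure_itv /= lte_fin ltr01 oppr0 adde0 => /eqP.
by rewrite eqe oner_eq0.
Qed.

(* Parabolic arcs from 0 to 1 with disjoint interiors. *)
Definition arc (c t : R) : C := Complex t (c * (t * (1 - t))).

(** The points p with A + p B in 2 pi i Z are countably many. A point with real part other than 0
    and 1 lies on exactly one arc, and an arc meets these two lines only at 0 and 1, where the
    hypotheses apply. So only countably many arcs are excluded. *)
Lemma arc_avoids (T : finType) (A B : T -> C) :
  (forall k, cexp (A k) != 1) -> (forall k, cexp (A k + B k) != 1) ->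
  exists c, forall k t, cexp (A k + arc c t * B k) != 1.
Proof.
move=> A1 AB1.
pose P (km : T * int) := (Complex 0 (pi *+ 2 *~ km.2) - A km.1) / B km.1.
(* The parameter of the arc through [p]. Where a denominator here or in [P] vanishes the value is
   junk; those cases are treated separately below. *)
pose bad km := let: p := P km in
  complex.Im p / (complex.Re p * (1 - complex.Re p)).
have [c cP] := avoid_countable bad; exists c => k t; apply/negP => /eqP.
move=> /cexp_eq1[m E].
have [B0|B0] := eqVneq (B k) 0.
  have := A1 k; rewrite -[A k]addr0 -[in X in _ + X](mulr0 (arc c t)) -B0 E.
  by rewrite /cexp /= expR0 !mul1r -[pi *+ 2 *~ m]add0r (periodicz (@cosD2pi R))
    (periodicz (@sinD2pi R)) cos0 sin0 eqxx.
have PE : P (k, m) = arc c t by rewrite /P /= -E addrAC subrr add0r mulfK.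
have m1 : cexp (Complex 0 (pi *+ 2 *~ m) : C) = 1.
  by rewrite /cexp /= expR0 !mul1r -[pi *+ 2 *~ m]add0r (periodicz (@cosD2pi R))
    (periodicz (@sinD2pi R)) cos0 sin0.
have t0 : t != 0.
  apply: contraNneq (A1 k) => t0; rewrite -m1 -E t0 /arc mul0r mulr0.
  by rewrite [Complex 0 0](_ : _ = 0)// mul0r addr0.
have t1 : t != 1.
  apply: contraNneq (AB1 k) => t1; rewrite -m1 -E t1 /arc subrr !mulr0.
  by rewrite [Complex 1 0](_ : _ = 1)// mul1r.
have /eqP := cP (k, m); apply; rewrite /bad PE /= mulfK//.
by rewrite mulf_neq0// subr_eq0 eq_sym.
Qed.

Lemma toC_continuous : continuous (toC : R -> C).
Proof.
move=> t; apply/cvgrPdist_lt => /= e e0.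
have /complex_realP[r rE] : e \is Num.real by rewrite realE ltW.
have r0 : 0 < r by rewrite -ltcR -rE.
near=> s; rewrite -rmorphB /= normc_def /= expr0n addr0 sqrtr_sqr rE ltcR.
near: s; exact: (@cvgr_dist_lt _ _ _ (nbhs t) _ id t cvg_id _ r0).
Unshelve. all: by end_near.
Qed.

Lemma cvg_Re (T : Type) (F : set_system T) (FF : Filter F) (f : T -> C) (l : C) :
  f x @[x --> F] --> l -> complex.Re (f x) @[x --> F] --> complex.Re l.
Proof.
move=> fl; apply/cvgrPdist_lt => /= e e0.
have e0' : 0 < toC e by rewrite ltcR.
near=> y; rewrite -ReB -ltcR; apply: le_lt_trans (normc_ge_Re _) _.
by near: y; move/cvgrPdist_lt: fl => /(_ _ e0').
Unshelve. all: by end_near.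
Qed.

Lemma arc_continuous c : continuous (arc c).
Proof.
move=> t; have -> : arc c = fun t => toC t + 'i%C * toC (c * (t * (1 - t))).
  by apply/funext => s; apply: complexP => /=; ring.
apply: cvgD; first exact: toC_continuous.
apply: cvgM; first exact: cvg_cst.
have ft : c * (s * (1 - s)) @[s --> t] --> c * (t * (1 - t)).
  apply: cvgM; first exact: cvg_cst.
  apply: cvgM; first exact: cvg_id.
  by apply: cvgB; [exact: cvg_cst|exact: cvg_id].
exact: cvg_comp ft (@toC_continuous _).
Qed.

End AvoidingPaths.

(** * The explicit square root and its uniqueness *)

Section SquareRootBranch.
Variables (R : realType) (n : nat).
Local Notation C := (C R).
Local Notation toC := (real_complex R).
Local Notation z := (@z R).
Implicit Types (a b : 'rV[C]_n) (D : {set 'I_n}).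

Definition pairf (x y : C) : C := q (x + y) / q (x - y).

(* [q] is even, and negative at nonzero reals, so that [pairf x y] is positive for
   distinct positive [x] and [y]. *)
Definition branch D a : C := \prod_(k in D) z (2 * a 0 k) *
  \prod_(k in D) \prod_(l in D | (k < l)%N) pairf (a 0 k) (a 0 l).

Lemma pairfC x y : pairf x y = pairf y x.
Proof. by rewrite /pairf [y + x]addrC -[q (y - x)]qN opprB. Qed.

(** Collecting the two orders of a pair lets the double products of the radicand be compared with
    the product over k < l in [branch]. *)
Lemma prod_offdiag D (G : 'I_n -> 'I_n -> C) :
  \prod_(k in D) \prod_(l in D | l != k) G k l =
  \prod_(k in D) \prod_(l in D | (k < l)%N) (G k l * G l k).
Proof.
under [RHS]eq_bigr do rewrite big_split /=.
rewrite big_split /= [X in _ = _ * X](exchange_big_dep (mem D)) /=; last by move=> k l _ /andP[].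
rewrite -big_split /=; apply: eq_bigr => k kD.
rewrite (bigID (fun l : 'I_n => (k < l)%N)) /=; congr (_ * _); apply: eq_bigl => l.
  rewrite -andbA; case: (l \in D) => //=; rewrite andbC.
  by case: ltnP => //= kl; apply/eqP => lk; rewrite lk ltnn in kl.
by rewrite kD -andbA -leqNgt; case: (l \in D) => //=; rewrite ltn_neqAle.
Qed.

Lemma generic_neq D a k l : generic D a -> k \in D -> l \in D -> k != l -> a 0 k != a 0 l.
Proof.
move=> ga kD lD kl; apply: contraTneq ((ga k l kD lD).2 kl) => ->.
by rewrite subrr cexp0 eqxx.
Qed.

Lemma generic_double D a k : generic D a -> k \in D -> cexp (2 * a 0 k) != 1.
Proof. by move=> ga kD; rewrite mulr_natl mulr2n (ga k k kD kD).1. Qed.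

(** At a generic point the factors omitted from [Zdag] are exactly the diagonal ones, so [Zdag] is
    the product of q(delta - eps) over unordered pairs. The two [Z] factors give the square of the
    product of q(delta + eps) times the diagonal product of q(2 delta), and the latter times Y(D) /
    Y(D^-) is Y(D)^2. *)
Lemma branch_sqr D a : generic D a -> branch D a ^+ 2 = radicand D a.
Proof.
move=> ga; rewrite /radicand /Y /Z /Zdag.
have -> : \prod_(i in D) \prod_(j in D | (- a) 0 i + a 0 j != 0) z ((- a) 0 i + a 0 j) =
    \prod_(k in D) \prod_(l in D | (k < l)%N) q (a 0 k - a 0 l).
  transitivity (\prod_(k in D) \prod_(l in D | (k < l)%N) (z (a 0 l - a 0 k) * z (a 0 k - a 0
    l))).
    rewrite -(@prod_offdiag D (fun k l => z (a 0 l - a 0 k))).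
    apply: eq_bigr => k kD; apply: eq_big => [l|l _]; last by rewrite mxE addrC.
    rewrite mxE; case: (boolP (l \in D)) => //= lD.
    rewrite addrC subr_eq0; have [->|lk] := eqVneq l k; first by rewrite eqxx.
    by rewrite (generic_neq ga).
  by apply: eq_bigr => k _; apply: eq_bigr => l _; rewrite /q opprB mulrC.
rewrite -big_split /=.
have -> : \prod_(i in D) ((\prod_(j in D) z (a 0 i + a 0 j)) *
    \prod_(j in D) z ((- a) 0 i + (- a) 0 j)) =
  \prod_(k in D) q (2 * a 0 k) * (\prod_(k in D) \prod_(l in D | (k < l)%N) q (a 0 k + a 0 l))
    ^+ 2.
  under eq_bigr do rewrite -big_split /=.
  rewrite -[RHS]/(_ * (_ * _)) -big_split /=.
  under [X in _ = _ * X]eq_bigr do rewrite -big_split /=.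
  rewrite (_ : \prod_(k in D) \prod_(l in D | (k < l)%N) _ =
    \prod_(k in D) \prod_(l in D | (k < l)%N) (q (a 0 k + a 0 l) * q (a 0 l + a 0 k))); last
      first.
    by apply: eq_bigr => k _; apply: eq_bigr => l _; rewrite [a 0 l + _]addrC.
  rewrite -(@prod_offdiag D (fun k l => q (a 0 k + a 0 l))) -big_split /=.
  apply: eq_bigr => k kD; rewrite (bigD1 k)//= !mxE -opprD -/(q _).
  rewrite mulr_natl mulr2n; congr (_ * _); apply: eq_bigr => l _.
  by rewrite !mxE -opprD.
have qd : \prod_(k in D) \prod_(l in D | (k < l)%N) q (a 0 k - a 0 l) != 0.
  apply/prodf_neq0 => k kD; apply/prodf_neq0 => l /andP[lD kl].
  by apply: q_neq0; apply: (ga k l kD lD).2; apply: contraTneq kl => ->; rewrite ltnn.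
have zd : \prod_(k in D) z (2 * (- a) 0 k) != 0.
  apply/prodf_neq0 => k kD; rewrite mxE mulrN z_neq0// cexpN_eq1.
  exact: generic_double ga kD.
rewrite /branch exprMn.
have -> : \prod_(k in D) \prod_(l in D | (k < l)%N) pairf (a 0 k) (a 0 l) =
  (\prod_(k in D) \prod_(l in D | (k < l)%N) q (a 0 k + a 0 l)) /
  (\prod_(k in D) \prod_(l in D | (k < l)%N) q (a 0 k - a 0 l)).
  by rewrite -prodf_div; apply: eq_bigr => k _; rewrite -prodf_div.
have -> : \prod_(k in D) q (2 * a 0 k) = \prod_(k in D) z (2 * a 0 k) * \prod_(k in D) z (2 *
  (- a) 0 k).
  by rewrite -big_split; apply: eq_bigr => k _; rewrite mxE mulrN.
move: qd zd; set x1 := \prod_(k in D) \prod_(l in D | _) _; set x2 := \prod_(k in D) z _.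
set x3 := \prod_(k in D) z _; set x4 := \prod_(k in D) \prod_(l in D | _) _ => x10 x20.
by field; rewrite x10 x20.
Qed.

Lemma cvg_z (T : Type) (F : set_system T) (FF : Filter F) (f : T -> C) (l : C) :
  cexp l != 1 -> f x @[x --> F] --> l -> z (f x) @[x --> F] --> z l.
Proof.
move=> l1 fl; have := @jet_z R l 1 0; rewrite mul1r addr0 => /(_ l1)/jet_holo hz.
have {}hz : holo l z.
  by apply: holo_near_eq hz; apply: nearC => w; rewrite mul1r addr0.
exact: cvg_comp fl (holo_continuous hz).
Qed.

Lemma cvg_q (T : Type) (F : set_system T) (FF : Filter F) (f : T -> C) (l : C) :
  cexp l != 1 -> f x @[x --> F] --> l -> q (f x) @[x --> F] --> q l.
Proof.
move=> l1 fl; apply: cvgM; first exact: cvg_z.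
by apply: cvg_z; [rewrite cexpN_eq1|exact: cvgN].
Qed.

Lemma cvg_branch (T : Type) (F : set_system T) (FF : Filter F) (f : T -> 'rV[C]_n) D a :
  generic D a -> (forall k, f x 0 k @[x --> F] --> a 0 k) ->
  branch D (f x) @[x --> F] --> branch D a.
Proof.
move=> ga fa; apply: cvgM.
  apply: cvg_big => [|k kD]; first exact: mul_continuous.
  apply: cvg_z; first exact: generic_double ga kD.
  by apply: cvgM => //; exact: cvg_cst.
apply: cvg_big => [|k kD]; first exact: mul_continuous.
apply: cvg_big => [|l /andP[lD kl]]; first exact: mul_continuous.
have kl' : k != l by apply: contraTneq kl => ->; rewrite ltnn.
have [g1 /(_ kl') g2] := ga k l kD lD.
apply: cvgM; first by apply: cvg_q => //; exact: cvgD.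
apply: cvgV; first exact: q_neq0.
by apply: cvg_q => //; exact: cvgB.
Qed.

Lemma branch_continuous D a : generic D a -> {for a, continuous (branch D)}.
Proof.
move=> ga; apply: (@cvg_branch _ (nbhs a) _ id) => // k.
exact: coord_continuous.
Qed.

Lemma z_real (r : R) : z (toC r) = toC (1 - expR (- r))^-1.
Proof.
rewrite /Defs.z fmorphV rmorphB rmorph1; congr (1 - _)^-1.
by apply: complexP => /=; rewrite oppr0 ?cos0 ?sin0 ?mulr1 ?mulr0.
Qed.

Lemma q_real_lt0 (r : R) : r != 0 -> q (toC r) < 0 :> C.
Proof.
move=> r0; rewrite /q -rmorphN !z_real -rmorphM /= -(rmorph0 toC) ltcR opprK.
have e1 : expR r != 1 by rewrite -expR0 (inj_eq (@expR_inj R)).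
have e0 := expR_gt0 r; rewrite expRN; set e := expR r in e0 e1 *.
have -> : (1 - e^-1)^-1 / (1 - e) = - (e / (1 - e) ^+ 2).
  by field; rewrite ?subr_eq0 ?(eq_sym 1) ?e1 ?gt_eqF.
rewrite oppr_lt0 divr_gt0// exprn_even_gt0//= subr_eq0 eq_sym//.
Qed.

Lemma branch_gt0 D a : generic D a -> (forall k, k \in D -> 0 < a 0 k) -> 0 < branch D a.
Proof.
move=> ga a0.
have ar k : k \in D -> exists2 r : R, a 0 k = toC r & 0 < r.
  move=> kD; have ak := a0 k kD; have /complex_realP[r rE] : a 0 k \is Num.real by rewrite
    realE ltW.
  by exists r => //; rewrite -ltcR -rE.
rewrite mulr_gt0//; apply: prodr_gt0 => k kD; have [r rE r0] := ar k kD.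
  rewrite rE -(rmorph_nat toC) -rmorphM z_real -(rmorph0 toC) ltcR invr_gt0 subr_gt0.
  by rewrite -expR0 ltr_expR oppr_lt0 mulr_gt0.
apply: prodr_gt0 => l /andP[lD kl]; have [s sE s0] := ar l lD.
have rs : r != s.
  apply: contraTneq kl => rs; rewrite -leqNgt.
  have [->//|lk] := eqVneq l k; have := generic_neq ga lD kD lk.
  by rewrite rE sE rs eqxx.
rewrite /pairf rE sE -rmorphD -rmorphB nmulr_rgt0 ?q_real_lt0 ?gt_eqF ?addr_gt0//.
by rewrite invr_lt0 q_real_lt0// subr_eq0.
Qed.

Lemma branchP D : is_sqrt_branch D (branch D).
Proof. split=> a; [exact: branch_continuous|exact: branch_sqr|exact: branch_gt0]. Qed.

Lemma branch_neq0 D a : generic D a -> branch D a != 0.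
Proof.
move=> ga; rewrite /branch; apply: mulf_neq0.
  by apply/prodf_neq0 => k kD; exact: z_neq0 (generic_double ga kD).
apply/prodf_neq0 => k kD; apply/prodf_neq0 => l /andP[lD kl].
have kl' : k != l by apply: contraTneq kl => ->; rewrite ltnn.
have [g1 /(_ kl') g2] := ga k l kD lD.
by apply: mulf_neq0; rewrite ?invr_eq0; exact: q_neq0.
Qed.

(** Distinct positive reals, so that this one point fixes the sign of the root for every [D]. *)
Definition basepoint : 'rV[C]_n := \row_k toC k.+1%:R.

Lemma cexp_toC (r : R) : cexp (toC r) = toC (expR r).
Proof. by apply: complexP; rewrite /= ?cos0 ?sin0 ?mulr1 ?mulr0. Qed.

Lemma cexp_toC_neq1 (r : R) : r != 0 -> cexp (toC r) != 1.
Proof.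
move=> r0; rewrite cexp_toC -(rmorph1 toC) (inj_eq (@complexI R)).
by rewrite -expR0 (inj_eq (@expR_inj R)).
Qed.

Lemma generic_basepoint D : generic D basepoint.
Proof.
move=> k l _ _; rewrite !mxE -rmorphD -rmorphB; split=> [|kl]; apply: cexp_toC_neq1.
  by rewrite gt_eqF// addr_gt0// ltr0n.
by rewrite subr_eq0 eqr_nat eqSS; exact: kl.
Qed.

(** Along a generic arc from [a] to the base point the quotient of the two roots is continuous with
    values 1 and -1, and it is 1 at the end. *)
Lemma branch_unique D (s : 'rV[C]_n -> C) a :
  is_sqrt_branch D s -> generic D a -> s a = branch D a.
Proof.
move=> [sc s2 s0] ga; pose b := basepoint; have gb : generic D b by exact: generic_basepoint.
(* Indices of the linear forms to be kept off 2 pi i Z: sums for [true], differences for [false]. A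
   diagonal difference would vanish, so it is replaced by the double, which is avoided anyway. *)
pose I := ({k : 'I_n | k \in D} * {k : 'I_n | k \in D} * bool)%type.
pose ell (v : 'rV[C]_n) (u : I) : C := let: (k, l, e) := u in
  if e then v 0 (val k) + v 0 (val l) else
  if k == l then 2 * v 0 (val k) else v 0 (val k) - v 0 (val l).
have ell1 v : generic D v -> forall u, cexp (ell v u) != 1.
  move=> gv [[[k kD] [l lD]] []] /=; first by case: (gv k l kD lD).
  case: ifP => kl; first exact: generic_double gv kD.
  by apply: (gv k l kD lD).2; rewrite -(inj_eq val_inj) /= in kl; rewrite kl.
have [||c cP] := @arc_avoids R _ (ell a) (fun u => ell b u - ell a u).
- exact: ell1.
- by move=> u; rewrite addrC subrK; exact: ell1.
pose g t := a + arc c t *: (b - a).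
have gg t : generic D (g t).
  have gE u : ell (g t) u = ell a u + arc c t * (ell b u - ell a u).
    move: u => [[k l] e] /=; rewrite !mxE.
    by case: e => //=; [|case: ifP => _]; ring.
  move=> k l kD lD; split=> [|kl].
    by have := cP (exist _ k kD, exist _ l lD, true) t; rewrite -gE.
  have := cP (exist _ k kD, exist _ l lD, false) t; rewrite -gE /=.
  by rewrite -(inj_eq val_inj) /= (negbTE kl).
pose r t := s (g t) / branch D (g t).
have r2 t : (r t == 1) || (r t == -1).
  have nz := branch_neq0 (gg t); rewrite -sqrf_eq1 /r expr_div_n s2// branch_sqr// divff//.
  by rewrite -branch_sqr// expf_neq0.
have gc t0 : g t @[t --> t0] --> g t0.
  apply: cvgD; first exact: cvg_cst.
  apply: cvgZr_tmp; exact: arc_continuous.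
have rc t0 : r t @[t --> t0] --> r t0.
  apply: cvgM; first exact: cvg_comp (gc t0) (sc _ (gg t0)).
  apply: cvgV; first exact: branch_neq0.
  exact: cvg_comp (gc t0) (@branch_continuous D _ (gg t0)).
have g0 : g 0 = a.
  by rewrite /g /arc mul0r mulr0 [Complex 0 0](_ : _ = 0)// scale0r addr0.
have g1 : g 1 = b.
  by rewrite /g /arc subrr !mulr0 [Complex 1 0](_ : _ = 1)// scale1r addrC subrK.
have b0 i : i \in D -> 0 < b 0 i by move=> _; rewrite mxE -(rmorph0 toC) ltcR ltr0n.
have r1 : r 1 = 1.
  have : 0 < r 1 by rewrite /r g1 divr_gt0 ?s0//; exact: branch_gt0.
  by case/orP: (r2 1) => /eqP -> //; rewrite oppr_gt0 ltr10.
case/orP: (r2 0) => /eqP r0.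
  by apply/eqP; rewrite -subr_eq0 -g0; move: r0; rewrite /r => /(canRL (divfK (branch_neq0 (gg
    0)))) ->; rewrite mul1r subrr.
(* If the quotient were -1 at [a], its real part would vanish somewhere on the arc. *)
have [||t _ rt] := @IVT R (fun t => complex.Re (r t)) 0 1 0 ler01.
- by apply: continuous_subspaceT => t; exact: cvg_Re (rc t).
- by rewrite r0 r1 /= minElt maxElt; case: ltP => h; lra.
by case/orP: (r2 t) => /eqP rE; move: rt; rewrite rE => /eqP; rewrite /= ?oppr_eq0 oner_eq0.
Qed.

Lemma sqrt_radicandE D a : generic D a -> sqrt_radicand D a = branch D a.
Proof.
move=> ga; rewrite /sqrt_radicand; case: xgetP => [s sE sP|h].
  exact: branch_unique.
by case: (h (branch D)); exact: branchP.
Qed.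

End SquareRootBranch.

(** * Simple poles *)

Section SimplePoles.
Variable R : realType.
Local Notation C := (C R).
Local Notation z := (@z R).
Local Notation cexp := (@cexp R).
Implicit Types (c w s d x : C) (f g u : C -> C).

(** [r] may be 0, and then the singularity is removable: regular terms and genuine poles are added
    by the same lemma. *)
Definition simple_pole c f r := exists2 g, holo c g &
  \forall w \near c^', f w = g w + r / (w - c).

Lemma simple_pole_near_eq c f g r : (\forall w \near c^', f w = g w) ->
  simple_pole c f r -> simple_pole c g r.
Proof.
move=> fg [h hh fE]; exists h => //.
by move: fg fE; apply: (@filterS2 _ (c^')) => w -> .
Qed.

Lemma simple_pole_eq c f r r' : simple_pole c f r -> r = r' -> simple_pole c f r'.
Proof. by move=> + <-. Qed.

Lemma simple_poleD c f g r r' : simple_pole c f r -> simple_pole c g r' ->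
  simple_pole c (fun w => f w + g w) (r + r').
Proof.
move=> [f1 hf fE] [g1 hg gE]; exists (fun w => f1 w + g1 w); first exact: holoD.
move: fE gE; apply: (@filterS2 _ (c^')) => w -> ->; rewrite mulrDl; ring.
Qed.

Lemma holo_simple_pole c f : holo c f -> simple_pole c f 0.
Proof. by move=> hf; exists f => //; apply: (@nearW _ (c^')) => w; rewrite mul0r addr0. Qed.

Lemma simple_pole_sum (I : finType) (P : pred I) c (F : I -> C -> C) (r : I -> C) :
  (forall i, P i -> simple_pole c (F i) (r i)) ->
  simple_pole c (fun w => \sum_(i | P i) F i w) (\sum_(i | P i) r i).
Proof.
move=> pF; rewrite [X in simple_pole _ X _](_ : _ = \sum_(i | P i) F i); last first.
  by apply/funext => w; rewrite fct_sumE.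
elim/big_rec2: _ => [|i y G Pi IH]; first exact: holo_simple_pole (holo_cst c 0).
exact: (simple_poleD (pF i Pi) IH).
Qed.

Lemma simple_pole_principal_part c f r : simple_pole c f r -> principal_part f c (r *: 'X).
Proof.
move=> [g hg fE]; split; first by rewrite coefZ coefX mulr0.
exists g; split=> //.
by move: fE; apply: (@filterS _ (c^')) => w ->; rewrite hornerZ hornerX.
Qed.

Lemma near_neq c : \forall w \near c^', w != c.
Proof. exact: (@nbhs_dnbhs_neq C). Qed.

Lemma near_punctured c (P : C -> Prop) : (\forall w \near c, P w) -> \forall w \near c^', P w.
Proof. exact: (@nbhs_dnbhs C). Qed.

(* The affine function [u] is kept abstract so that arguments of [z] need not be
   put in the form [s * w + d]. *)
Lemma simple_pole_z c s u f a0 a1 : s != 0 -> (forall w, u w = s * (w - c)) ->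
  jet c f a0 a1 -> simple_pole c (fun w => z (u w) * f w) (a0 / s).
Proof.
move=> s0 uE jf; have [g hg gE] := jetM (jet_xz c s) jf.
exists (fun w => s^-1 * ((a1 + s / 2 * a0) + (w - c) * g w)).
  apply: holoZ; exact: holoD (holo_cst c _) (holoM (holo_sub c) hg).
move: (near_punctured gE) (near_neq c); apply: (@filterS2 _ (c^')) => w gw wc.
have wc0 : w - c != 0 by rewrite subr_eq0.
have swc : s * (w - c) != 0 by rewrite mulf_neq0.
rewrite uE (zE swc) mulrAC gw; field.
by rewrite wc0 s0.
Qed.

Lemma qE x : x != 0 -> q x = - (xz x * xz (- x)) / x ^+ 2.
Proof.
move=> x0; have Nx0 : - x != 0 by rewrite oppr_eq0.
by rewrite /q (zE x0) (zE Nx0); field.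
Qed.

Lemma jet_xzxz c : jet c (fun w => xz (w - c) * xz (- (w - c))) 1 0.
Proof.
have := jetM (jet_xz c 1) (jet_xz c (-1)); rewrite !mulr1 mul1r => j.
apply: (jet_eq (jet_near_eq _ j)) => //; last by field.
by apply: nearC => w; rewrite mul1r mulN1r.
Qed.

(** As [q] is even, it is -1 / x^2 plus a regular function. A zero of [f] therefore leaves a simple
    pole, whose residue is minus the derivative of [f]. *)
Lemma simple_pole_q c u f a1 : (forall w, u w = w - c) ->
  jet c f 0 a1 -> simple_pole c (fun w => q (u w) * f w) (- a1).
Proof.
move=> uE jf; have [g hg gE] := jetM (jet_xzxz c) jf.
exists (fun w => - 1 * g w); first exact: holoZ.
move: (near_punctured gE) (near_neq c); apply: (@filterS2 _ (c^')) => w gw wc.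
have wc0 : w - c != 0 by rewrite subr_eq0.
have -> : q (u w) * f w = - (xz (w - c) * xz (- (w - c)) * f w) / (w - c) ^+ 2.
  by rewrite uE (qE wc0); ring.
rewrite gw; field.
exact: wc0.
Qed.

(** 1 / q has a double zero. It occurs at equal arguments, through the denominator of [pairf]. *)
Lemma simple_pole_invq c u f a0 a1 : (forall w, u w = w - c) ->
  jet c f a0 a1 -> simple_pole c (fun w => (q (u w))^-1 * f w) 0.
Proof.
move=> uE jf; have jx := jet_xzxz c; have x0 := jet_neq0 jx (oner_neq0 _).
have hV := holoV (jet_holo jx) x0.
exists (fun w => - 1 * ((w - c) * (w - c)) * (xz (w - c) * xz (- (w - c)))^-1 * f w).
  by apply: holoM (jet_holo jf); apply: holoM hV; apply: holoZ; exact: holoM (holo_sub c)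
    (holo_sub c).
move: (near_punctured x0) (near_neq c); apply: (@filterS2 _ (c^')) => w xw wc.
have wc0 : w - c != 0 by rewrite subr_eq0.
move: xw; rewrite uE (qE wc0) mulf_eq0 negb_or => /andP[x1 x2]; field.
by rewrite wc0 x1 x2.
Qed.

Lemma jet_zu c s u : (forall w, u w = u c + s * (w - c)) -> cexp (u c) != 1 ->
  jet c (fun w => z (u w)) (z (u c)) (s * q (u c)).
Proof.
move=> uE u1; have E : s * c + (u c - s * c) = u c by ring.
have := @jet_z R c s (u c - s * c); rewrite E => /(_ u1); apply: jet_near_eq.
by apply: nearC => w; rewrite (uE w); congr z; ring.
Qed.

(** q = z (1 - z) and z' = q give q' = q (1 - 2 z). *)
Lemma jet_qu c s u : (forall w, u w = u c + s * (w - c)) -> cexp (u c) != 1 ->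
  jet c (fun w => q (u w)) (q (u c)) (s * q (u c) * (1 - 2 * z (u c))).
Proof.
move=> uE u1; have Nu1 : cexp (- u c) != 1 by rewrite cexpN_eq1.
have NuE w : - u w = - u c + - s * (w - c) by rewrite uE; ring.
have := jetM (jet_zu uE u1) (jet_zu (u := fun w => - u w) NuE Nu1).
move=> j; apply: (@jet_eq _ _ (fun w => q (u w)) _ _ _ _ j) => //.
rewrite qN (zN u1) /q (zN u1); ring.
Qed.

Lemma jet_cexpu c s u : (forall w, u w = u c + s * (w - c)) ->
  jet c (fun w => cexp (u w)) (cexp (u c)) (s * cexp (u c)).
Proof.
move=> uE; have E : s * c + (u c - s * c) = u c by ring.
have := @jet_cexp R c s (u c - s * c); rewrite E; apply: jet_near_eq.
by apply: nearC => w; rewrite (uE w); congr cexp; ring.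
Qed.

Lemma near_cexp_affine_punctured c s d : s != 0 -> \forall w \near dnbhs c, cexp (s * w + d) != 1.
Proof.
move=> s0; have [E1|E1] := eqVneq (cexp (s * c + d)) 1; last first.
  by apply: near_punctured; exact: near_cexp_affine_neq1.
have /holo_continuous hc := jet_holo (jet_affine c s (- (s * c))).
have near0 : \forall w \near c, s * w - s * c != 0 -> cexp (s * w - s * c) != 1.
  have : \forall y \near (s * c - s * c), y != 0 -> cexp y != 1.
    by rewrite subrr; exact: near_cexp_neq1.
  by move=> /hc; rewrite nbhs_simpl.
move: (near_punctured near0) (near_neq c).
apply: (@filterS2 _ (dnbhs c)) => w h wc.
have -> : s * w + d = s * c + d + (s * w - s * c) by ring.
by rewrite cexpD E1 mul1r h// -mulrBr mulf_neq0// subr_eq0.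
Qed.

(** In the proof that the residue is not identically zero, this carries regularity at equal
    arguments over to the term in which beta is replaced by - beta. *)
Lemma simple_poleN (f : C -> C) c r : simple_pole c f r ->
  simple_pole (- c) (fun w => f (- w)) (- r).
Proof.
move=> [g hg fE]; exists (fun w => g (- 1 * w + 0)).
  by apply: holo_comp_affine; rewrite mulN1r opprK addr0.
have /holo_continuous hc := jet_holo (jet_affine (- c) (- 1) 0).
have fE' : \forall w \near c, w != c -> f w = g w + r / (w - c).
  by move: fE; rewrite /dnbhs/within.
have : \forall w \near (- 1 * (- c) + 0), w != c -> f w = g w + r / (w - c).
  by rewrite mulN1r opprK addr0.
move=> /hc; rewrite nbhs_simpl /= => /near_punctured h.
move: h (near_neq (- c)); apply: (@filterS2 _ (dnbhs (- c))) => w + wc.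
rewrite /= mulN1r addr0 eqr_oppLR => -> //; congr (_ + _).
by rewrite opprK -opprD invrN mulrN mulNr.
Qed.

Lemma simple_pole_neq0 (f : C -> C) c r : simple_pole c f r -> r != 0 ->
  \forall w \near dnbhs c, f w != 0.
Proof.
move=> [g hg fE] r0.
have hh := holoD (holoM (holo_sub c) hg) (holo_cst c r).
have /(near_neq0 (holo_continuous hh)) : (c - c) * g c + r != 0.
  by rewrite subrr mul0r add0r.
move=> /near_punctured h; move: h fE (near_neq c).
apply: (@filterS3 _ (dnbhs c)) => w h -> wc; apply: contraNneq h => f0.
have wc0 : w - c != 0 by rewrite subr_eq0.
have -> : (w - c) * g w + r = (w - c) * (g w + r / (w - c)) by field.
by rewrite f0 mulr0.
Qed.

End SimplePoles.

(** * Poles of J^* *)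

Local Close Scope classical_set_scope.

Section ExplicitJstar.
Variables (R : realType) (N n : nat).
Local Notation C := (C R).
Local Notation z := (@z R).
Local Notation q := (@q R).
Local Notation cexp := (@cexp R).
Implicit Types (v : 'I_n -> C) (D S B : {set 'I_n}) (x w : C) (i j k : 'I_n).

Definition upd v i w k : C := if k == i then w else v k.

Definition expz w : C := cexp (- (2 * N)%:R * w) * z (2 * w).

Definition pairprod v D w : C := \prod_(k in D) pairf w (v k).

(** The change of the singleton weight of [k] when a variable with value [w] joins [D]. *)
Definition hshift v w k : C := z (w - v k) - z (- v k - w).

Definition hsing v D w : C :=
  \sum_(d in D) (z (v d - w) - z (- w - v d)) - z (- (2 * w)).

Definition hpair v (W : {set 'I_n}) : C := - q (\sum_(k in W) v k).

(** Sign, exponential and square root together, with the first two distributed over the elements of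
    [D]. *)
Definition coef v D : C := \prod_(k in D) - expz (v k) *
  \prod_(k in D) \prod_(l in D | (k < l)%N) pairf (v k) (v l).

(* The summand of [J^*(A)] indexed by [D], with [S = A :\: D]. *)
Definition Jterm v D S : C := coef v D * match_sum (fun k => hsing v D (v k)) (hpair v) S.

(* [generic] for a valuation given as a function. *)
Definition nonresonant v B :=
  forall k l, k \in B -> l \in B ->
    cexp (v k + v l) != 1 /\ (k != l -> cexp (v k - v l) != 1).

Lemma hpair2 v k l : k != l -> hpair v [set k; l] = - q (v k + v l).
Proof. by move=> kl; rewrite /hpair big_setU1 ?inE//= big_set1. Qed.

Lemma JstarE (A : {set 'I_n}) (a : 'rV[C]_n) : generic A a ->
  Jstar N A a = \sum_(D : {set 'I_n} | D \subset A) Jterm (a 0) D (A :\: D).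
Proof.
move=> ga; apply: eq_bigr => D DA.
have gD : generic D a by move=> k l kD lD; apply: ga; exact: (fintype.subsetP DA).
rewrite sqrt_radicandE// /Jterm; congr (_ * _); last first.
  apply: eq_bigr => P /andP[PE /forallP P2]; apply: eq_bigr => W WP.
  have /fintype.subsetP WE := partitionS PE WP.
  rewrite /H; case: ifPn => W1.
    apply: eq_bigr => k /WE; rewrite inE => /andP[kD kA].
    rewrite dlogzE; last exact: generic_double ga kA.
    rewrite /hsing; congr (_ - _); apply: eq_bigr => d dD.
    have dA := fintype.subsetP DA _ dD.
    have kd : k != d by apply: contraNneq kD => ->.
    have [g1 /(_ kd) g2] := ga k d kA dA.
    by rewrite (dlogzE g1) (dlogzE g2) opprB opprD.
  have := implyP (P2 W) WP; have := partition_neq0 PE WP; rewrite -card_gt0 => W0 W2.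
  have W2' : #|W| == 2%N by move: W1 W0 W2; case: #|W| => [|[|[]]].
  have /cards2P[k [l [kl Wkl]]] := W2'.
  have kA : k \in A by have := WE k; rewrite Wkl !inE eqxx => /(_ isT) /andP[].
  have lA : l \in A by have := WE l; rewrite Wkl !inE eqxx orbT => /(_ isT) /andP[].
  rewrite Wkl hpair2// big_setU1 ?inE//= big_set1 ddlogzE//.
  exact: (ga k l kA lA).1.
rewrite /branch /coef mulrA; congr (_ * _).
have -> : cexp (- (2 * N)%:R * \sum_(d in D) a 0 d) = \prod_(d in D) cexp (- (2 * N)%:R * a 0 d).
  rewrite mulr_sumr; elim/big_rec2: _ => [|k x y _ <-]; [exact: cexp0|exact: cexpD].
rewrite -mulrA [X in _ * X]mulrC mulrA -big_split /=.
rewrite -[(-1) ^+ _]/((-1) ^+ #|D|) -prodr_const -big_split /=.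
by apply: eq_bigr => k _; rewrite /expz mulrN1.
Qed.

Lemma eq_Jterm v v' D S : {in D :|: S, v =1 v'} -> Jterm v D S = Jterm v' D S.
Proof.
move=> vv; have vD k : k \in D -> v k = v' k by move=> kD; rewrite vv// inE kD.
have vS k : k \in S -> v k = v' k by move=> kS; rewrite vv// inE kS orbT.
rewrite /Jterm /coef; congr (_ * _ * _).
- by apply: eq_bigr => k kD; rewrite vD.
- by apply: eq_bigr => k kD; apply: eq_bigr => l /andP[lD _]; rewrite !vD.
apply: eq_match_sum => [k kS|k l kS lS kl]; last by rewrite !hpair2// !vS.
rewrite /hsing (vS k)//; congr (_ - _); apply: eq_bigr => d dD; by rewrite vD.
Qed.

Lemma upd_out v i w k : k != i -> upd v i w k = v k.
Proof. by rewrite /upd => /negbTE ->. Qed.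

Lemma upd_in v i w : upd v i w i = w.
Proof. by rewrite /upd eqxx. Qed.

Lemma notin_neq (B : {set 'I_n}) i k : i \notin B -> k \in B -> k != i.
Proof. by move=> iB kB; apply: contraNneq iB => <-. Qed.

Lemma Jterm_upd v i w D S : i \notin D -> i \notin S -> Jterm (upd v i w) D S = Jterm v D S.
Proof.
move=> iD iS; apply: eq_Jterm => k; rewrite inE => /orP[] kX; rewrite upd_out//.
  exact: notin_neq iD kX.
exact: notin_neq iS kX.
Qed.

(** [pairf] is symmetric, so the position of [i] in the order of the indices does not matter. *)
Lemma coefU1 v i D : i \notin D ->
  coef v (i |: D) = - expz (v i) * pairprod v D (v i) * coef v D.
Proof.
move=> iD; rewrite /coef big_setU1//= -!mulrA; congr (_ * _).
rewrite [RHS]mulrCA; congr (_ * _).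
rewrite [LHS]big_setU1//=.
have E k : k \in D -> \prod_(l in i |: D | (k < l)%N) pairf (v k) (v l) =
    (if (k < i)%N then pairf (v i) (v k) else 1) * \prod_(l in D | (k < l)%N) pairf (v k) (v l).
  by move=> kD; rewrite !big_mkcondr big_setU1//= pairfC.
rewrite [X in _ * X = _](eq_bigr _ E) [X in _ * X = _]big_split /= mulrA; congr (_ * _).
have -> : \prod_(l in i |: D | (i < l)%N) pairf (v i) (v l) =
    \prod_(l in D) (if (i < l)%N then pairf (v i) (v l) else 1).
  by rewrite big_mkcondr big_setU1//= ltnn mul1r.
rewrite -big_split; apply: eq_bigr => k kD /=.
case: (ltngtP i k) => ik; rewrite ?mulr1 ?mul1r//.
by move: (notin_neq iD kD); rewrite -(inj_eq val_inj) /= ik eqxx.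
Qed.

Lemma hsingU1 v i D w : i \notin D ->
  hsing v (i |: D) w = (z (v i - w) - z (- w - v i)) + hsing v D w.
Proof. by move=> iD; rewrite /hsing big_setU1//= addrA. Qed.

(** This lemma and [Jterm_out] isolate the dependence on the value [w] of one variable. Inside the
    subset it contributes a factor and shifts every singleton weight; outside, it is a block of its
    own or paired with some [k]. *)
Lemma Jterm_in v i w D S : i \notin D -> i \notin S ->
  Jterm (upd v i w) (i |: D) S = - (expz w * pairprod v D w) *
    (coef v D * match_sum (fun k => hshift v w k + hsing v D (v k)) (hpair v) S).
Proof.
move=> iD iS.
have vD k : k \in D -> upd v i w k = v k by move=> kD; rewrite upd_out// (notin_neq iD kD).
have vS k : k \in S -> upd v i w k = v k by move=> kS; rewrite upd_out// (notin_neq iS kS).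
rewrite /Jterm coefU1// upd_in [RHS]mulrA; congr (_ * _).
  rewrite -(mulNr (expz w)); congr (_ * _ * _); first by apply: eq_bigr => k kD; rewrite vD.
  rewrite /coef; congr (_ * _); first by apply: eq_bigr => k kD; rewrite vD.
  by apply: eq_bigr => k kD; apply: eq_bigr => l /andP[lD _]; rewrite !vD.
apply: eq_match_sum => [k kS|k l kS lS kl]; last by rewrite !hpair2// !vS.
rewrite hsingU1// upd_in vS// /hshift /hsing; congr (_ + (_ - _)).
by apply: eq_bigr => d dD; rewrite vD.
Qed.

Lemma Jterm_out v i w D S : i \notin D -> i \notin S ->
  Jterm (upd v i w) D (i |: S) = coef v D *
    (hsing v D w * match_sum (fun k => hsing v D (v k)) (hpair v) S -
     \sum_(k in S) q (w + v k) * match_sum (fun k => hsing v D (v k)) (hpair v) (S :\ k)).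
Proof.
move=> iD iS.
have vD k : k \in D -> upd v i w k = v k by move=> kD; rewrite upd_out// (notin_neq iD kD).
have vS k : k \in S -> upd v i w k = v k by move=> kS; rewrite upd_out// (notin_neq iS kS).
have hD x : hsing (upd v i w) D x = hsing v D x.
  by rewrite /hsing; congr (_ - _); apply: eq_bigr => d dD; rewrite vD.
have mE (S' : {set 'I_n}) : S' \subset S ->
    match_sum (fun k => hsing (upd v i w) D (upd v i w k)) (hpair (upd v i w)) S' =
    match_sum (fun k => hsing v D (v k)) (hpair v) S'.
  move=> /fintype.subsetP SS; apply: eq_match_sum => [k /SS kS|k l /SS kS /SS lS kl].
    by rewrite hD vS.
  by rewrite !hpair2// !vS.
rewrite /Jterm; congr (_ * _).
  rewrite /coef; congr (_ * _); first by apply: eq_bigr => k kD; rewrite vD.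
  by apply: eq_bigr => k kD; apply: eq_bigr => l /andP[lD _]; rewrite !vD.
rewrite match_sumU1// upd_in hD mE// -sumrN; congr (_ + _).
apply: eq_bigr => k kS; have ik : i != k by rewrite eq_sym (notin_neq iS kS).
by rewrite hpair2// upd_in vS// mulNr mE// subD1set.
Qed.

End ExplicitJstar.

Local Open Scope classical_set_scope.

Section RegularFunctions.
Variable R : realType.
Local Notation C := (C R).
Local Notation z := (@z R).
Local Notation q := (@q R).
Local Notation cexp := (@cexp R).
Implicit Types (c s w : C) (f g u : C -> C).

(** For cofactors of which only the value enters a residue. *)
Definition has_jet c f := exists a1, jet c f (f c) a1.

Lemma jet_has_jet c f a0 a1 : jet c f a0 a1 -> has_jet c f.
Proof. by move=> jf; exists a1; rewrite (jet_value jf). Qed.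

Lemma has_jet_cst c a : has_jet c (fun=> a).
Proof. exact: jet_has_jet (jet_cst c a). Qed.

Lemma has_jetD c f g : has_jet c f -> has_jet c g -> has_jet c (fun w => f w + g w).
Proof. by move=> [a1 jf] [b1 jg]; exact: jet_has_jet (jetD jf jg). Qed.

Lemma has_jetB c f g : has_jet c f -> has_jet c g -> has_jet c (fun w => f w - g w).
Proof. by move=> [a1 jf] [b1 jg]; exact: jet_has_jet (jetB jf jg). Qed.

Lemma has_jetN c f : has_jet c f -> has_jet c (fun w => - f w).
Proof. by move=> [a1 jf]; exact: jet_has_jet (jetN jf). Qed.

Lemma has_jetM c f g : has_jet c f -> has_jet c g -> has_jet c (fun w => f w * g w).
Proof. by move=> [a1 jf] [b1 jg]; exact: jet_has_jet (jetM jf jg). Qed.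

Lemma has_jetZ c a f : has_jet c f -> has_jet c (fun w => a * f w).
Proof. by move=> [a1 jf]; exact: jet_has_jet (jetZ a jf). Qed.

Lemma has_jet_sum (I : finType) (P : pred I) c (F : I -> C -> C) :
  (forall i, P i -> has_jet c (F i)) -> has_jet c (fun w => \sum_(i | P i) F i w).
Proof.
move=> jF; rewrite [X in has_jet _ X](_ : _ = \sum_(i | P i) F i); last first.
  by apply/funext => w; rewrite fct_sumE.
elim/big_rec: _ => [|i G Pi IH]; first exact: has_jet_cst.
exact: has_jetD (jF i Pi) IH.
Qed.

Lemma has_jet_prod (I : finType) (P : pred I) c (F : I -> C -> C) :
  (forall i, P i -> has_jet c (F i)) -> has_jet c (fun w => \prod_(i | P i) F i w).
Proof.
move=> jF; rewrite [X in has_jet _ X](_ : _ = \prod_(i | P i) F i); last first.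
  by apply/funext => w; rewrite fct_prodE.
elim/big_rec: _ => [|i G Pi IH]; first exact: has_jet_cst.
exact: has_jetM (jF i Pi) IH.
Qed.

Lemma has_jet_match_sum (I : finType) c (h : I -> C -> C) (g : {set I} -> C) (S : {set I}) :
  (forall k, k \in S -> has_jet c (h k)) ->
  has_jet c (fun w => match_sum (fun k => h k w) g S).
Proof.
move=> jh; have /choice[h1 h1P] : forall k, exists a1, k \in S -> jet c (h k) (h k c) a1.
  by move=> k; case: (boolP (k \in S)) => [/jh[a1 ?]|_]; [exists a1|exists 0].
exact: jet_has_jet (jet_match_sum g h1P).
Qed.

Lemma simple_pole_has_jet c f : has_jet c f -> simple_pole c f 0.
Proof. by move=> [a1 /jet_holo]; exact: holo_simple_pole. Qed.

Lemma simple_pole_z_has_jet c s u f : s != 0 -> (forall w, u w = s * (w - c)) ->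
  has_jet c f -> simple_pole c (fun w => z (u w) * f w) (f c / s).
Proof. by move=> s0 uE [a1]; exact: simple_pole_z. Qed.

Lemma eq_simple_pole c f g r : (forall w, f w = g w) -> simple_pole c f r -> simple_pole c g r.
Proof. by move=> fg; apply: simple_pole_near_eq; exact: (@nearW _ (c^')). Qed.

(** The logarithmic derivative of [q] is 1 - 2 z, and the constants cancel in the quotient. *)
Lemma jet_pairf c (x : C) : cexp (c + x) != 1 -> cexp (c - x) != 1 ->
  jet c (fun w => pairf w x) (pairf c x) (2 * pairf c x * (z (c - x) - z (c + x))).
Proof.
move=> p1 m1.
have jp := @jet_qu R c 1 (fun w => w + x) _ p1.
have jm := @jet_qu R c 1 (fun w => w - x) _ m1.
apply: jet_eq (jetM (jp _) (jetV (jm _) (q_neq0 m1))) _ _ => // [w|w|]; try ring.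
have q0 := q_neq0 m1; move: q0; rewrite /pairf.
set qm := q _; set qp := q _; set zm := z _; set zp := z _ => q0; field.
exact: q0.
Qed.

Lemma has_jet_affine_z c s u : (forall w, u w = u c + s * (w - c)) -> cexp (u c) != 1 ->
  has_jet c (fun w => z (u w)).
Proof. by move=> uE u1; exact: jet_has_jet (jet_zu uE u1). Qed.

Lemma has_jet_affine_q c s u : (forall w, u w = u c + s * (w - c)) -> cexp (u c) != 1 ->
  has_jet c (fun w => q (u w)).
Proof. by move=> uE u1; exact: jet_has_jet (jet_qu uE u1). Qed.

End RegularFunctions.

Local Close Scope classical_set_scope.

(** * Regularity of the cofactors away from the other variables and their negatives *)

Section JtermRegularity.
Variables (R : realType) (N n : nat) (v : 'I_n -> C R) (c : C R) (B : {set 'I_n}).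
Hypothesis cv : forall k, k \in B -> cexp (c + v k) != 1 /\ cexp (c - v k) != 1.
Local Notation C := (C R).
Local Notation z := (@z R).
Local Notation q := (@q R).
Local Notation cexp := (@cexp R).
Implicit Types (D S : {set 'I_n}) (w : C).

Lemma has_jet_qD k : k \in B -> has_jet c (fun w => q (w + v k)).
Proof.
move=> /cv[p1 _]; apply: (@has_jet_affine_q _ _ 1 (fun w => w + v k)) => // w; ring.
Qed.

Lemma jet_hshift k : k \in B ->
  jet c (fun w => hshift v w k) (hshift v c k) (q (c - v k) + q (c + v k)).
Proof.
move=> /cv[p1 m1]; have Np1 : cexp (- v k - c) != 1 by rewrite -opprD; apply: cexpN_neq1;
  rewrite addrC.
have jp := @jet_zu R c (-1) (fun w => - v k - w) _ Np1.
have jm := @jet_zu R c 1 (fun w => w - v k) _ m1.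
apply: jet_eq (jetB (jm _) (jp _)) _ _ => // [w|w|]; try ring.
by rewrite mul1r mulN1r opprK -[q (- v k - c)]qN opprB opprK [c + _]addrC.
Qed.

Lemma has_jet_hsing_part D : D \subset B ->
  has_jet c (fun w => \sum_(d in D) (z (v d - w) - z (- w - v d))).
Proof.
move=> /fintype.subsetP DB; apply: has_jet_sum => d /DB /cv[p1 m1]; apply: has_jetB.
  apply: (@has_jet_affine_z _ _ (-1) (fun w => v d - w)) => [w|]; first ring.
  by rewrite -opprB; exact: cexpN_neq1.
apply: (@has_jet_affine_z _ _ (-1) (fun w => - w - v d)) => [w|]; first ring.
by rewrite -opprD; exact: cexpN_neq1.
Qed.

Lemma has_jet_hsing D : D \subset B -> cexp (2 * c) != 1 -> has_jet c (hsing v D).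
Proof.
move=> DB c2; apply: has_jetB; first exact: has_jet_hsing_part.
apply: (@has_jet_affine_z _ _ (-2) (fun w => - (2 * w))) => [w|]; first ring.
exact: cexpN_neq1.
Qed.

Lemma has_jet_pairprod D : D \subset B -> has_jet c (pairprod v D).
Proof.
move=> /fintype.subsetP DB; apply: has_jet_prod => k /DB/cv[p1 m1].
exact: jet_has_jet (jet_pairf p1 m1).
Qed.

Lemma has_jet_match_sum_hshift (h0 : 'I_n -> C) g S : S \subset B ->
  has_jet c (fun w => match_sum (fun k => hshift v w k + h0 k) g S).
Proof.
move=> /fintype.subsetP SB; apply: (@has_jet_match_sum _ _ _ (fun k w => hshift v w k + h0 k))
  => k /SB kB.
apply: has_jetD; [exact: jet_has_jet (jet_hshift kB)|exact: has_jet_cst].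
Qed.

Lemma has_jet_qsum (f : 'I_n -> C) S : S \subset B ->
  has_jet c (fun w => \sum_(k in S) q (w + v k) * f k).
Proof.
move=> /fintype.subsetP SB; apply: has_jet_sum => k /SB kB.
by apply: has_jetM; [exact: has_jet_qD|exact: has_jet_cst].
Qed.

Lemma has_jet_cexp (s : C) : has_jet c (fun w => cexp (s * w)).
Proof.
by apply: jet_has_jet (@jet_cexpu _ c s (fun w => s * w) _) => w; ring.
Qed.

Lemma has_jet_expz : cexp (2 * c) != 1 -> has_jet c (expz N).
Proof.
move=> c2; apply: has_jetM; first exact: has_jet_cexp.
by apply: (@has_jet_affine_z _ _ 2 (fun w => 2 * w)) => // w; ring.
Qed.

End JtermRegularity.

(** * Poles of the terms with a fixed part in the remaining variables *)

Section JtermPoles.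
Variables (R : realType) (N n : nat).
Local Notation C := (C R).
Local Notation z := (@z R).
Local Notation q := (@q R).
Local Notation cexp := (@cexp R).
Local Notation Jterm := (@Jterm R N n).
Local Notation expz := (@expz R N).
Local Notation coef := (@coef R N n).
Implicit Types (v : 'I_n -> C) (D S B : {set 'I_n}) (w : C) (i j k : 'I_n).

Lemma nonresonant_double v B k : nonresonant v B -> k \in B -> cexp (2 * v k) != 1.
Proof. by move=> gv kB; rewrite mulr_natl mulr2n (gv k k kB kB).1. Qed.

Lemma nonresonant_single v B k : nonresonant v B -> k \in B -> cexp (v k) != 1.
Proof.
move=> gv kB; apply: contraNneq (nonresonant_double gv kB) => v1.
by rewrite mulr_natl mulr2n cexpD v1 mulr1.
Qed.

(** Outside the subset the variable has the pole of - z(-2w) in its singleton weight; inside, that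
    of z(2w). The cofactors agree up to sign at w = 0, where the exponential and every [pairf] are 1
    ([q] is even) and every shift is 0. *)
Lemma simple_pole_at0 v i B D : i \notin B -> nonresonant v B -> D \subset B ->
  simple_pole 0 (fun w => Jterm (upd v i w) D (i |: (B :\: D)) +
                          Jterm (upd v i w) (i |: D) (B :\: D)) 0.
Proof.
move=> iB gv DB; set S := B :\: D; have SB : S \subset B by exact: subsetDl.
have iD : i \notin D by apply: contra iB; exact: (fintype.subsetP DB).
have iS : i \notin S by apply: contra iB; exact: (fintype.subsetP SB).
have cv k : k \in B -> cexp (0 + v k) != 1 /\ cexp (0 - v k) != 1.
  move=> /(nonresonant_single gv) v1; rewrite add0r sub0r.
  by split=> //; exact: cexpN_neq1.
pose g := hpair v; pose M S' := match_sum (fun k => hsing v D (v k)) g S'.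
pose f0 w := - (cexp (- (2 * N)%:R * w) * pairprod v D w) *
  (coef v D * match_sum (fun k => hshift v w k + hsing v D (v k)) g S).
pose r0 w := coef v D * (\sum_(d in D) (z (v d - w) - z (- w - v d)) * M S -
  \sum_(k in S) q (w + v k) * M (S :\ k)).
apply: (@eq_simple_pole _ _ (fun w => z (- (2 * w)) * - (coef v D * M S) + r0 w + z (2 * w) *
  f0 w)).
  move=> w; rewrite (Jterm_in N v w iD iS) (Jterm_out N v w iD iS) /f0 /r0.
  have -> : hsing v D w = \sum_(d in D) (z (v d - w) - z (- w - v d)) - z (- (2 * w)) by [].
  have -> : expz w = cexp (- (2 * N)%:R * w) * z (2 * w) by [].
  rewrite -/g -/(M S) -mulr_suml; ring.
have two0 : (2 : C) != 0 by rewrite pnatr_eq0.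
have p1 : simple_pole 0 (fun w => z (- (2 * w)) * - (coef v D * M S)) (- (coef v D * M S) / -2).
  apply: (@simple_pole_z_has_jet _ _ (-2) (fun w => - (2 * w)) (fun=> - (coef v D * M S))) =>
    [|w|].
  - by rewrite oppr_eq0.
  - ring.
  - exact: has_jet_cst.
have p2 : simple_pole 0 r0 0.
  apply: simple_pole_has_jet; apply: has_jetZ; apply: has_jetB; last exact: (has_jet_qsum cv
    (fun k => M (S :\ k)) SB).
  apply: (@has_jet_sum _ _ _ _ (fun d w => (z (v d - w) - z (- w - v d)) * M S)) => d dD.
  have /fintype.subsetP/(_ d dD) dB := DB; have [p1' m1'] := cv d dB.
  apply: has_jetM (has_jet_cst _ _); apply: has_jetB.
    apply: (@has_jet_affine_z _ _ (-1) (fun w => v d - w)) => [w|]; first ring.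
    by rewrite -opprB; exact: cexpN_neq1.
  apply: (@has_jet_affine_z _ _ (-1) (fun w => - w - v d)) => [w|]; first ring.
  by rewrite -opprD; exact: cexpN_neq1.
have p3 : simple_pole 0 (fun w => z (2 * w) * f0 w) (f0 0 / 2).
  apply: simple_pole_z_has_jet => // [w|]; first ring.
  apply: has_jetM; first apply: has_jetN.
    apply: has_jetM; first exact: has_jet_cexp.
    exact: has_jet_pairprod cv _ DB.
  by apply: has_jetZ; exact: has_jet_match_sum_hshift cv _ _ _ SB.
apply: simple_pole_eq (simple_poleD (simple_poleD p1 p2) p3) _.
have -> : f0 0 = - (coef v D * M S).
  rewrite /f0 mulr0 cexp0 mul1r /pairprod big1 ?mulN1r => [|k kD]; last first.
    rewrite /pairf add0r sub0r qN divff// q_neq0//.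
    have /fintype.subsetP/(_ k kD) kB := DB; exact: nonresonant_single gv kB.
  congr (- (_ * _)); apply: eq_match_sum => // k kS.
  by rewrite /hshift sub0r subr0 subrr add0r.
by field.
Qed.

Section TwoVariables.
Variables (v : 'I_n -> C) (i j : 'I_n) (B D : {set 'I_n}).
Hypotheses (ijB : i \notin j |: B) (jB : j \notin B) (gv : nonresonant v (j |: B)) (DB : D
  \subset B).
Let S := B :\: D.
Let b := v j.
Let g := hpair v.
(** [M], [Mw] and [Mwb] are the matching sums when none, one or both of the two distinguished
    variables belong to the subset. *)
Let M S' := match_sum (fun k => hsing v D (v k)) g S'.
Let Mw w S' := match_sum (fun k => hshift v w k + hsing v D (v k)) g S'.
Let Mwb w := match_sum (fun k => hshift v w k + (hshift v b k + hsing v D (v k))) g S.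

Let SB : S \subset B. Proof. exact: subsetDl. Qed.
Let iB : i \notin B. Proof. by apply: contra ijB; rewrite !inE orbC => ->. Qed.
Let ij : i != j. Proof. by apply: contraNneq ijB => ->; rewrite setU11. Qed.
Let iD : i \notin D. Proof. by apply: contra iB; exact: (fintype.subsetP DB). Qed.
Let iS : i \notin S. Proof. by apply: contra iB; exact: (fintype.subsetP SB). Qed.
Let jD : j \notin D. Proof. by apply: contra jB; exact: (fintype.subsetP DB). Qed.
Let jS : j \notin S. Proof. by apply: contra jB; exact: (fintype.subsetP SB). Qed.
Let ijD : i \notin j |: D. Proof. by rewrite !inE negb_or ij. Qed.
Let ijS : i \notin j |: S. Proof. by rewrite in_setU1 negb_or ij. Qed.

Let bv k : k \in B -> cexp (b + v k) != 1 /\ cexp (b - v k) != 1.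
Proof.
move=> kB; have jk : j != k by apply: contraNneq jB => ->.
have jjB := setU11 j B; have kjB : k \in j |: B by rewrite inE kB orbT.
by have [g1 /(_ jk) g2] := gv jjB kjB.
Qed.

Let Nbv k : k \in B -> cexp (- b + v k) != 1 /\ cexp (- b - v k) != 1.
Proof.
move=> /bv[p m]; have -> : - b + v k = - (b - v k) by ring.
have -> : - b - v k = - (b + v k) by ring.
by split; exact: cexpN_neq1.
Qed.

Let b2 : cexp (2 * b) != 1.
Proof. exact: nonresonant_double gv (setU11 _ _). Qed.

Let Nb2 : cexp (2 * - b) != 1.
Proof. by rewrite mulrN; exact: cexpN_neq1. Qed.

Let b2E : 2 * b = b + b. Proof. by rewrite mulr_natl mulr2n. Qed.

(** The block [[set i; j]] is written separately: it alone is singular at w = - b. *)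
Lemma Jterm_neither w : Jterm (upd v i w) D (i |: (j |: S)) =
  coef v D * (hsing v D w * M (j |: S) -
    (q (w + b) * M S + \sum_(k in S) q (w + v k) * M ((j |: S) :\ k))).
Proof.
by rewrite (Jterm_out N v w iD ijS) [X in _ - X]big_setU1//= setU1K.
Qed.

Lemma Jterm_first w : Jterm (upd v i w) (i |: D) (j |: S) =
  - (expz w * pairprod v D w) * (coef v D *
    (((z (w - b) - z (- b - w)) + hsing v D b) * Mw w S +
     \sum_(k in S) g [set j; k] * Mw w (S :\ k))).
Proof. by rewrite (Jterm_in N v w iD ijS) match_sumU1. Qed.

Lemma coef_second : coef v (j |: D) = - (expz b * pairprod v D b) * coef v D.
Proof. by rewrite coefU1// mulNr. Qed.

Lemma hsing_second x : hsing v (j |: D) x = (z (b - x) - z (- x - b)) + hsing v D x.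
Proof. exact: hsingU1. Qed.

Lemma Mw_second S' : match_sum (fun k => hsing v (j |: D) (v k)) g S' = Mw b S'.
Proof. by apply: eq_match_sum => // k _; rewrite hsing_second. Qed.

Lemma Jterm_second w : Jterm (upd v i w) (j |: D) (i |: S) =
  - (expz b * pairprod v D b) * coef v D *
    (((z (b - w) - z (- w - b)) + hsing v D w) * Mw b S -
     \sum_(k in S) q (w + v k) * Mw b (S :\ k)).
Proof.
rewrite (Jterm_out N v w ijD iS) coef_second hsing_second -/g Mw_second.
by congr (_ * (_ - _)); apply: eq_bigr => k _; rewrite Mw_second.
Qed.

Lemma Jterm_both w : Jterm (upd v i w) (i |: (j |: D)) S =
  (expz w * (pairf w b * pairprod v D w)) *
  (expz b * pairprod v D b * coef v D * Mwb w).
Proof.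
rewrite (Jterm_in N v w ijD iS) coef_second.
have -> : pairprod v (j |: D) w = pairf w b * pairprod v D w by rewrite /pairprod big_setU1.
have -> : match_sum (fun k => hshift v w k + hsing v (j |: D) (v k)) (hpair v) S = Mwb w.
  by apply: eq_match_sum => // k _; rewrite hsing_second.
ring.
Qed.

(** The poles sit in the mixed terms: z(w - b) in the shift of the weight of [j], and z(b - w) in
    the weight of [i]. Their cofactors coincide at w = b. *)
Lemma simple_pole_at_equal : simple_pole b (fun w =>
  (Jterm (upd v i w) D (i |: (j |: S)) + Jterm (upd v i w) (i |: D) (j |: S)) +
  (Jterm (upd v i w) (j |: D) (i |: S) + Jterm (upd v i w) (i |: (j |: D)) S)) 0.
Proof.
have q2b : cexp (b + b) != 1 by rewrite -b2E.
have p00 : simple_pole b (fun w => Jterm (upd v i w) D (i |: (j |: S))) 0.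
  apply: eq_simple_pole (fun w => esym (Jterm_neither w)) _.
  apply: simple_pole_has_jet; apply: has_jetZ; apply: has_jetB.
    by apply: has_jetM; [exact: has_jet_hsing bv _ DB b2|exact: has_jet_cst].
  apply: has_jetD; last exact: (has_jet_qsum bv (fun k => M ((j |: S) :\ k)) SB).
  apply: has_jetM; last exact: has_jet_cst.
  by apply: (@has_jet_affine_q _ _ 1 (fun w => w + b)) => // w; ring.
have jE : has_jet b (fun w => expz w * pairprod v D w).
  by apply: has_jetM; [exact: has_jet_expz|exact: has_jet_pairprod bv _ DB].
have jM S' : S' \subset B -> has_jet b (fun w => Mw w S').
  exact: has_jet_match_sum_hshift bv _ _ _.
pose f10 w := - (expz w * pairprod v D w) * (coef v D * Mw w S).
have p10 : simple_pole b (fun w => Jterm (upd v i w) (i |: D) (j |: S)) (f10 b / 1).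
  pose r10 w := - (expz w * pairprod v D w) * (coef v D *
    ((hsing v D b - z (- b - w)) * Mw w S + \sum_(k in S) g [set j; k] * Mw w (S :\ k))).
  apply: (@eq_simple_pole _ _ (fun w => z (w - b) * f10 w + r10 w)).
    by move=> w; rewrite Jterm_first /f10 /r10; ring.
  rewrite -[X in simple_pole _ _ X]addr0; apply: simple_poleD.
    apply: simple_pole_z_has_jet => [|w|]; [exact: oner_neq0|by rewrite mul1r|].
    by apply: has_jetM; [exact: has_jetN|apply: has_jetZ; exact: jM].
  apply: simple_pole_has_jet; apply: has_jetM; first exact: has_jetN.
  apply: has_jetZ; apply: has_jetD.
    apply: has_jetM; last exact: jM.
    apply: has_jetB; first exact: has_jet_cst.
    apply: (@has_jet_affine_z _ _ (-1) (fun w => - b - w)) => [w|]; first ring.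
    by rewrite -opprD; exact: cexpN_neq1.
  apply: has_jet_sum => k kS; apply: has_jetZ; apply: jM.
  exact: fintype.subset_trans (subD1set _ _) SB.
pose c01 := - (expz b * pairprod v D b) * coef v D.
have p01 : simple_pole b (fun w => Jterm (upd v i w) (j |: D) (i |: S)) (c01 * Mw b S / -1).
  pose r01 w := c01 * ((hsing v D w - z (- w - b)) * Mw b S -
     \sum_(k in S) q (w + v k) * Mw b (S :\ k)).
  apply: (@eq_simple_pole _ _ (fun w => z (b - w) * (c01 * Mw b S) + r01 w)).
    by move=> w; rewrite Jterm_second /r01 /c01; ring.
  rewrite -[X in simple_pole _ _ X]addr0; apply: simple_poleD.
    apply: (@simple_pole_z_has_jet _ _ (-1) (fun w => b - w) (fun=> c01 * Mw b S)) => [|w|].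
    - by rewrite oppr_eq0 oner_eq0.
    - ring.
    - exact: has_jet_cst.
  apply: simple_pole_has_jet; apply: has_jetZ; apply: has_jetB; last exact: (has_jet_qsum bv
    (fun k => Mw b (S :\ k)) SB).
  apply: has_jetM; last exact: has_jet_cst.
  apply: has_jetB; first exact: has_jet_hsing bv _ DB b2.
  apply: (@has_jet_affine_z _ _ (-1) (fun w => - w - b)) => [w|]; first ring.
  by rewrite -opprD; exact: cexpN_neq1.
have p11 : simple_pole b (fun w => Jterm (upd v i w) (i |: (j |: D)) S) 0.
  pose f11 w := q (w + b) * ((expz w * pairprod v D w) * (expz b * pairprod v D b * coef v D *
    Mwb w)).
  apply: (@eq_simple_pole _ _ (fun w => (q (w - b))^-1 * f11 w)).
    by move=> w; rewrite Jterm_both /f11 /pairf; ring.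
  have [a1 ja] : has_jet b f11.
    apply: has_jetM.
      by apply: (@has_jet_affine_q _ _ 1 (fun w => w + b)) => // w; ring.
    apply: has_jetM => //; apply: has_jetZ.
    exact: has_jet_match_sum_hshift bv _ _ _ SB.
  exact: (@simple_pole_invq _ _ (fun w => w - b) _ _ _ _ ja).
apply: simple_pole_eq (simple_poleD (simple_poleD p00 p10) (simple_poleD p01 p11)) _.
by rewrite /f10 /c01 divr1 divrN divr1; ring.
Qed.

(** Used to recognise the singleton blocks of b and - b in the residue. The constant comes from
    z(2b) + z(-2b) = 1, and the sum is the derivative found in [jet_pairprod2]. *)
Lemma hsingD_opp : hsing v D b + hsing v D (- b) =
  - 1 - \sum_(k in D) 2 * (z (b - v k) - z (b + v k)).
Proof.
rewrite /hsing; have -> : - (2 * - b) = 2 * b by ring.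
rewrite (zN b2).
have E k : k \in D -> z (v k - b) - z (- b - v k) + (z (v k - - b) - z (- - b - v k)) =
    - (2 * (z (b - v k) - z (b + v k))).
  move=> kD; have [p m] := bv (fintype.subsetP DB _ kD).
  have -> : v k - b = - (b - v k) by ring.
  have -> : - b - v k = - (b + v k) by ring.
  by rewrite (zN p) (zN m) opprK [v k + b]addrC; ring.
have ES : \sum_(d in D) (z (v d - b) - z (- b - v d)) +
    \sum_(d in D) (z (v d - - b) - z (- - b - v d)) =
    - \sum_(k in D) 2 * (z (b - v k) - z (b + v k)).
  by rewrite -big_split -sumrN; exact: eq_bigr E.
rewrite -ES; ring.
Qed.

(** Evenness of [q] makes [pairf] at - b the inverse of [pairf] at b, so each factor has value 1. *)
Lemma jet_pairprod2 : jet (- b) (fun w => \prod_(k in D) (pairf w (v k) * pairf b (v k))) 1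
  (\sum_(k in D) 2 * (z (b - v k) - z (b + v k))).
Proof.
apply: jet_prod1 => k kD; have kB := fintype.subsetP DB _ kD.
have [p m] := bv kB; have [Np Nm] := Nbv kB.
have qp := q_neq0 p; have qm := q_neq0 m.
have e1 : - b + v k = - (b - v k) by ring.
have e2 : - b - v k = - (b + v k) by ring.
apply: (jet_eq (jetM (jet_pairf Np Nm) (jet_cst (- b) (pairf b (v k))))).
  by rewrite /pairf e1 e2 !qN; field; rewrite qp qm.
rewrite /pairf e1 e2 !qN (zN p) (zN m); move: qp qm.
set zp := z (b + v k); set zm := z (b - v k); set qp := q (b + v k); set qm := q (b - v k).
by move=> qp0 qm0; field; rewrite qp0 qm0.
Qed.

(** Origin of the term with 2N. At w = - b the exponentials cancel and the rest is q(2b) / q(2b).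
    The logarithmic derivative is - 2N from the exponential, 2 z(2b) from z(2w), and - 1 + 2 z(-2b)
    from 1 / q; the values of [z] add up to 2. *)
Lemma jet_expz2 : jet (- b) (fun w => expz w * expz b * (q (w - b))^-1) 1 (1 - (2 * N)%:R).
Proof.
have e : - b - b = - (2 * b) by rewrite b2E; ring.
have q1 : cexp (- b - b) != 1 by rewrite e; exact: cexpN_neq1.
have e2 : 2 * - b = - (2 * b) by ring.
have jc := @jet_cexpu R (- b) (- (2 * N)%:R) (fun w => - (2 * N)%:R * w).
have jz := @jet_zu R (- b) 2 (fun w => 2 * w).
have jq := @jet_qu R (- b) 1 (fun w => w - b).
have E0 : cexp (- (2 * N)%:R * - b) * cexp (- (2 * N)%:R * b) = 1.
  by rewrite -cexpD -mulrDr addNr mulr0 cexp0.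
have := jetM (jetM (jetM (jc _) (jz _ Nb2)) (jet_cst (- b) (expz b))) (jetV (jq _ q1) (q_neq0
  q1)).
have aff1 w : - (2 * N)%:R * w = - (2 * N)%:R * - b + - (2 * N)%:R * (w - - b) by ring.
have aff2 w : 2 * w = 2 * - b + 2 * (w - - b) by ring.
have aff3 w : w - b = - b - b + 1 * (w - - b) by ring.
move=> /(_ aff1 aff2 aff3); rewrite e e2.
have eE : expz b = cexp (- (2 * N)%:R * b) * z (2 * b) by [].
have z0 := z_neq0 b2; have z1 := z_neq0 (cexpN_neq1 b2).
rewrite eE qN /q (zN b2); move: E0 z0 z1; rewrite (zN b2).
set Z := z (2 * b); set E1 := cexp (_ * - b); set E2 := cexp (_ * b).
move=> E0 z0 z1 jj; have E20 : E2 != 0 by exact: cexp_neq0.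
have E1E : E1 = E2^-1 by rewrite -(mulfK E20 E1) E0 div1r.
by apply: (jet_eq jj); rewrite E1E; field; rewrite E20 z0 z1.
Qed.

(** The shifts caused by b and - b are opposite, so the value is the unshifted sum. *)
Lemma jet_Mwb : jet (- b) Mwb (M S) (\sum_(k in S) (q (b - v k) + q (b + v k)) * M (S :\ k)).
Proof.
apply: (@jet_match_sum R _ (- b) (fun k w => hshift v w k + (hshift v b k + hsing v D (v k)))
  (fun k => hsing v D (v k)) (fun k => q (b - v k) + q (b + v k))) => k kS.
have kB := fintype.subsetP SB _ kS.
apply: (jet_eq (jetD (jet_hshift Nbv kB) (jet_cst (- b) (hshift v b k + hsing v D (v k))))).
  by rewrite /hshift opprK [- v k + b]addrC -opprD [- (b + v k)]opprD [- v k - b]addrC; ring.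
have -> : - b + v k = - (b - v k) by ring.
have -> : - b - v k = - (b + v k) by ring.
by rewrite !qN addr0 addrC.
Qed.

(** The residue identity holds separately for each [D]. [upd v j b] is [v] itself; the form lets
    [Jterm_in] and [Jterm_out] treat b and - b alike. *)
Lemma simple_pole_at_opp : simple_pole (- b) (fun w =>
  (Jterm (upd v i w) D (i |: (j |: S)) + Jterm (upd v i w) (i |: D) (j |: S)) +
  (Jterm (upd v i w) (j |: D) (i |: S) + Jterm (upd v i w) (i |: (j |: D)) S))
  (Jterm (upd v j b) D (j |: S) + Jterm (upd v j b) (j |: D) S +
   (Jterm (upd v j (- b)) D (j |: S) + Jterm (upd v j (- b)) (j |: D) S) +
   (2 * N)%:R * Jterm v D S).
Proof.
pose P := \sum_(k in D) 2 * (z (b - v k) - z (b + v k)).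
pose Q := \sum_(k in S) (q (b - v k) + q (b + v k)) * M (S :\ k).
(* The terms with both and with neither variable in the subset have singular part q(w + b) F(w).
   Both [Psi] and [Mwb] take their unperturbed values at - b, so F(- b) = 0. *)
pose Psi w := expz w * expz b * (q (w - b))^-1 * \prod_(k in D) (pairf w (v k) * pairf b (v k)).
pose F w := coef v D * (Psi w * Mwb w - M S).
have jF : jet (- b) F 0 (coef v D * ((1 - (2 * N)%:R + P) * M S + Q)).
  have jP := jetM (jetM jet_expz2 jet_pairprod2) jet_Mwb.
  by apply: (jet_eq (jetZ (coef v D) (jetB jP (jet_cst (- b) (M S))))); rewrite /P /Q; ring.
have jE : has_jet (- b) (fun w => expz w * pairprod v D w).
  by apply: has_jetM; [exact: has_jet_expz|exact: has_jet_pairprod Nbv _ DB].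
have jM S' : S' \subset B -> has_jet (- b) (fun w => Mw w S').
  exact: has_jet_match_sum_hshift Nbv _ _ _.
have jdiff : has_jet (- b) (fun w => z (w - b)).
  apply: (@has_jet_affine_z _ _ 1 (fun w => w - b)) => [w|]; first ring.
  by rewrite -opprD -b2E; exact: cexpN_neq1.
have jdiffN : has_jet (- b) (fun w => z (b - w)).
  apply: (@has_jet_affine_z _ _ (-1) (fun w => b - w)) => [w|]; first ring.
  by rewrite opprK -b2E.
have m1 : (-1 : C) != 0 by rewrite oppr_eq0 oner_eq0.
pose r00 w := coef v D * (hsing v D w * M (j |: S) - \sum_(k in S) q (w + v k) * M ((j |: S) :\
  k)).
pose f10 w := expz w * pairprod v D w * (coef v D * Mw w S).
pose r10 w := - (expz w * pairprod v D w) * (coef v D *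
  ((hsing v D b + z (w - b)) * Mw w S + \sum_(k in S) g [set j; k] * Mw w (S :\ k))).
pose c01 := - (expz b * pairprod v D b) * coef v D.
pose r01 w := c01 * ((hsing v D w + z (b - w)) * Mw b S - \sum_(k in S) q (w + v k) * Mw b (S
  :\ k)).
have pF := simple_pole_q (u := fun w => w + b) (fun w => congr1 (+%R w) (esym (opprK b))) jF.
have p10 : simple_pole (- b) (fun w => z (- b - w) * f10 w) (f10 (- b) / -1).
  apply: simple_pole_z_has_jet => // [w|]; first ring.
  by apply: has_jetM => //; apply: has_jetZ; exact: jM.
have p01 : simple_pole (- b) (fun w => z (- w - b) * - (c01 * Mw b S)) (- (c01 * Mw b S) / -1).
  apply: (@simple_pole_z_has_jet _ _ (-1) (fun w => - w - b) (fun=> - (c01 * Mw b S))) => //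
    [w|]; first ring.
  exact: has_jet_cst.
have hr : simple_pole (- b) (fun w => r00 w + r10 w + r01 w) 0.
  apply: simple_pole_has_jet; apply: has_jetD; first apply: has_jetD.
  - apply: has_jetZ; apply: has_jetB; last exact: (has_jet_qsum Nbv (fun k => M ((j |: S) :\
    k)) SB).
    by apply: has_jetM; [exact: has_jet_hsing Nbv _ DB Nb2|exact: has_jet_cst].
  - apply: has_jetM; first exact: has_jetN.
    apply: has_jetZ; apply: has_jetD.
      by apply: has_jetM; [apply: has_jetD => //; exact: has_jet_cst|exact: jM].
    apply: has_jet_sum => k kS; apply: has_jetZ; apply: jM.
    exact: fintype.subset_trans (subD1set _ _) SB.
  - apply: has_jetZ; apply: has_jetB; last exact: (has_jet_qsum Nbv (fun k => Mw b (S :\ k)) SB).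
    apply: has_jetM; last exact: has_jet_cst.
    by apply: has_jetD => //; exact: has_jet_hsing Nbv _ DB Nb2.
have := simple_poleD (simple_poleD (simple_poleD pF p10) p01) hr.
move/simple_pole_eq => pT; apply: (@eq_simple_pole _ _ _ _ _ _ (pT _ _)).
  move=> w; rewrite Jterm_neither Jterm_first Jterm_second Jterm_both /F /Psi /r00 /f10 /r10
    /r01 /c01.
  by rewrite big_split -/(pairprod v D w) -/(pairprod v D b) /pairf /=; ring.
rewrite !(Jterm_out N v _ jD jS) !(Jterm_in N v _ jD jS) -/g.
rewrite -/(M S) -/(Mw b S) -/(Mw (- b) S).
have -> : Jterm v D S = coef v D * M S by [].
(* Eliminating this sum through [Q], and then [hsing v D b] through [P], leaves a polynomial
   identity. *)
have -> : \sum_(k in S) q (b + v k) * match_sum (fun k0 => hsing v D (v k0)) g (S :\ k) =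
  Q - \sum_(k in S) q (- b + v k) * match_sum (fun k0 => hsing v D (v k0)) g (S :\ k).
  rewrite /Q -sumrB; apply: eq_bigr => k _; have -> : - b + v k = - (b - v k) by ring.
  by rewrite qN -/(M (S :\ k)); ring.
have -> : hsing v D b = - 1 - P - hsing v D (- b) by rewrite -hsingD_opp; ring.
rewrite /f10 /c01 divrN divrN !divr1; ring.
Qed.

End TwoVariables.

End JtermPoles.

(** * Residues of the full sum, and a point where the residue is nonzero *)

Section JstarPoles.
Variables (R : realType) (N n : nat).
Local Notation C := (C R).
Local Notation toC := (real_complex R).
Local Notation z := (@z R).
Local Notation cexp := (@cexp R).
Local Notation Jterm := (@Jterm R N n).
Implicit Types (a : 'rV[C]_n) (D B : {set 'I_n}) (c w : C) (i j k : 'I_n).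

Lemma update_row a i w : update a i w 0 = upd (a 0) i w.
Proof. by apply/funext => k; rewrite mxE. Qed.

Lemma update_id a i : update a i (a 0 i) = a.
Proof. by apply/rowP => k; rewrite mxE; case: eqP => // ->. Qed.

Lemma update_update a i w w' : update (update a i w) i w' = update a i w'.
Proof. by apply/rowP => k; rewrite !mxE; case: eqP. Qed.

Lemma generic_subset D B a : D \subset B -> generic B a -> generic D a.
Proof. by move=> /fintype.subsetP DB gB k l /DB kB /DB; exact: gB. Qed.

Lemma generic_out a i w B : i \notin B -> generic B a -> generic B (update a i w).
Proof.
move=> iB gB k l kB lB; rewrite !mxE !ifN ?(notin_neq iB)//.
exact: gB.
Qed.

Lemma generic_update a i w B : generic B a -> cexp (2 * w) != 1 ->
  (forall k, k \in B -> cexp (w + a 0 k) != 1 /\ cexp (w - a 0 k) != 1) ->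
  generic (i |: B) (update a i w).
Proof.
move=> gB w2 wB k l; rewrite !inE !mxE => /orP kB /orP lB.
have w2' : cexp (w + w) != 1 by move: w2; rewrite mulr_natl mulr2n.
case: (eqVneq k i) kB => [->|ki] kB; case: (eqVneq l i) lB => [->|li] lB.
- by [].
- by case: lB => // /wB[p m]; split.
- by case: kB => // /wB[p m]; rewrite addrC -opprB; split=> // _; exact: cexpN_neq1.
by case: kB lB => // kB [] // lB; exact: gB.
Qed.

Lemma near_generic_update a i c B : generic B a ->
  \forall w \near dnbhs c, generic (i |: B) (update a i w).
Proof.
move=> gB.
have h2 : \forall w \near dnbhs c, cexp (2 * w) != 1.
  have := @near_cexp_affine_punctured _ c 2 0; rewrite pnatr_eq0 => /(_ isT).
  by apply: (@filterS _ (dnbhs c)) => w; rewrite addr0.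
have hB : \forall w \near dnbhs c, forall k, cexp (w + a 0 k) != 1 /\ cexp (w - a 0 k) != 1.
  apply: (@filter_forall _ _ _ (dnbhs c)) => k.
  have := @near_cexp_affine_punctured _ c 1 (a 0 k) (oner_neq0 _).
  have := @near_cexp_affine_punctured _ c 1 (- a 0 k) (oner_neq0 _).
  by apply: (@filterS2 _ (dnbhs c)) => w; rewrite mul1r.
move: h2 hB; apply: (@filterS2 _ (dnbhs c)) => w w2 wB.
by apply: generic_update => // k _.
Qed.

Lemma setU1D i B D : i \notin B -> D \subset B -> (i |: B) :\: D = i |: (B :\: D).
Proof.
move=> iB DB; apply/setP => k; rewrite !inE; case: eqVneq => [->|] //=.
by rewrite (contra (fintype.subsetP DB i)).
Qed.

Lemma setU1DU1 i B D : i \notin B -> (i |: B) :\: (i |: D) = B :\: D.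
Proof.
move=> iB; apply/setP => k; rewrite !inE; case: eqVneq => [->|] //=.
by rewrite (negbTE iB) andbF.
Qed.

Lemma JstarU1 a i w B : i \notin B -> generic (i |: B) (update a i w) ->
  Jstar N (i |: B) (update a i w) = \sum_(D : {set 'I_n} | D \subset B)
    (Jterm (upd (a 0) i w) D (i |: (B :\: D)) + Jterm (upd (a 0) i w) (i |: D) (B :\: D)).
Proof.
move=> iB g; rewrite JstarE// update_row big_subsetU1//; apply: eq_bigr => D DB.
by rewrite setU1D// setU1DU1.
Qed.

Lemma JstarU2 a i j w B : i \notin j |: B -> j \notin B ->
  generic (i |: (j |: B)) (update a i w) ->
  Jstar N (i |: (j |: B)) (update a i w) = \sum_(D : {set 'I_n} | D \subset B)
    ((Jterm (upd (a 0) i w) D (i |: (j |: (B :\: D))) +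
      Jterm (upd (a 0) i w) (i |: D) (j |: (B :\: D))) +
     (Jterm (upd (a 0) i w) (j |: D) (i |: (B :\: D)) +
      Jterm (upd (a 0) i w) (i |: (j |: D)) (B :\: D))).
Proof.
move=> iB jB g; rewrite JstarU1// big_subsetU1//; apply: eq_bigr => D DB.
by rewrite setU1D// setU1DU1.
Qed.

Lemma Jstar_pole_at0 a i B : i \notin B -> generic B a ->
  simple_pole 0 (fun w => Jstar N (i |: B) (update a i w)) 0.
Proof.
move=> iB gB; apply: (@simple_pole_near_eq _ _ (fun w => \sum_(D : {set 'I_n} | D \subset B)
    (Jterm (upd (a 0) i w) D (i |: (B :\: D)) + Jterm (upd (a 0) i w) (i |: D) (B :\: D)))).
  move: (near_generic_update i 0 gB); apply: (@filterS _ (dnbhs (0 : C))) => w gw.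
  by rewrite JstarU1.
have := simple_pole_sum (P := fun D : {set 'I_n} => D \subset B) (r := fun=> 0)
  (fun D DB => simple_pole_at0 N iB gB DB).
by rewrite big1.
Qed.

Section TwoVariables.
Variables (a : 'rV[C]_n) (i j : 'I_n) (B : {set 'I_n}).
Hypotheses (iB : i \notin j |: B) (jB : j \notin B) (gB : generic (j |: B) a).

Lemma generic_update_opp : generic (j |: B) (update a j (- a 0 j)).
Proof.
have gB' := generic_subset (finset.subsetU1 j B) gB.
apply: generic_update => // [|k kB].
  by rewrite mulrN; apply: cexpN_neq1; exact: generic_double gB (setU11 _ _).
have jk : j != k by apply: contraNneq jB => ->.
have kjB : k \in j |: B by rewrite inE kB orbT.
have [p /(_ jk) m] := gB (setU11 j B) kjB.
have -> : - a 0 j + a 0 k = - (a 0 j - a 0 k) by ring.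
have -> : - a 0 j - a 0 k = - (a 0 j + a 0 k) by ring.
by split; exact: cexpN_neq1.
Qed.

Lemma Jstar_pole_at_opp :
  simple_pole (- a 0 j) (fun w => Jstar N (i |: (j |: B)) (update a i w)) (Jstar_residue N B j a).
Proof.
have gB' := generic_subset (finset.subsetU1 j B) gB.
apply: (@simple_pole_near_eq _ _ (fun w => \sum_(D : {set 'I_n} | D \subset B)
    ((Jterm (upd (a 0) i w) D (i |: (j |: (B :\: D))) +
      Jterm (upd (a 0) i w) (i |: D) (j |: (B :\: D))) +
     (Jterm (upd (a 0) i w) (j |: D) (i |: (B :\: D)) +
      Jterm (upd (a 0) i w) (i |: (j |: D)) (B :\: D))))).
  move: (near_generic_update i (- a 0 j) gB); apply: (@filterS _ (dnbhs (- a 0 j))) => w gw.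
  by rewrite JstarU2.
apply: simple_pole_eq (simple_pole_sum (fun D DB => simple_pole_at_opp N iB jB gB DB)) _.
rewrite !big_split /= -big_distrr -2!big_split /= /Jstar_residue.
rewrite (JstarE N gB') -JstarU1 -?JstarU1 ?update_id//.
exact: generic_update_opp.
Qed.

Lemma Jstar_pole_at_equal :
  simple_pole (a 0 j) (fun w => Jstar N (i |: (j |: B)) (update a i w)) 0.
Proof.
apply: (@simple_pole_near_eq _ _ (fun w => \sum_(D : {set 'I_n} | D \subset B)
    ((Jterm (upd (a 0) i w) D (i |: (j |: (B :\: D))) +
      Jterm (upd (a 0) i w) (i |: D) (j |: (B :\: D))) +
     (Jterm (upd (a 0) i w) (j |: D) (i |: (B :\: D)) +
      Jterm (upd (a 0) i w) (i |: (j |: D)) (B :\: D))))).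
  move: (near_generic_update i (a 0 j) gB); apply: (@filterS _ (dnbhs (a 0 j))) => w gw.
  by rewrite JstarU2.
have := simple_pole_sum (P := fun D : {set 'I_n} => D \subset B) (r := fun=> 0)
  (fun D DB => simple_pole_at_equal N iB jB gB DB).
by rewrite big1.
Qed.

End TwoVariables.

Lemma Jstar_residue_neq0 (N_gt0 : (0 < N)%N) B j : j \notin B ->
  exists2 a : 'rV[C]_n, generic (j |: B) a & Jstar_residue N B j a != 0.
Proof.
have [m] := ubnP #|B|; elim: m B j => // m IH B j Bm jB.
have [->|[k kB]] := set_0Vmem B.
  pose a : 'rV[C]_n := const_mx 1.
  have ga w : cexp (2 * w) != 1 -> generic (j |: finset.set0) (update a j w).
    by move=> w2; apply: generic_update => // [k l|k]; rewrite inE.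
  have JE w : cexp (2 * w) != 1 ->
      Jstar N (j |: finset.set0) (update a j w) = - z (- (2 * w)) - expz N w.
    move=> /ga gw; rewrite JstarU1 ?inE// (big_pred1 finset.set0) => [|D]; last by rewrite
      finset.subset0.
    rewrite finset.setD0 Jterm_out ?inE// Jterm_in ?inE// /coef /pairprod /hsing !big_set0
      !match_sum0.
    by ring.
  have c2 : cexp (2 * 1) != 1 :> C.
    by rewrite mulr1 -(rmorph_nat toC) cexp_toC_neq1// pnatr_eq0.
  have cN2 : cexp (2 * - 1) != 1 :> C by rewrite mulrN; exact: cexpN_neq1.
  exists (update a j 1); first exact: ga.
  rewrite /Jstar_residue update_update mxE eqxx !JE// JstarE; last by move=> k l; rewrite inE.
  rewrite (big_pred1 finset.set0) => [|D]; last by rewrite finset.subset0.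
  rewrite finset.set0D.
  have -> v : Jterm v finset.set0 finset.set0 = 1 by rewrite /Jterm /coef !big_set0 match_sum0
    !mulr1.
  (* At beta = 1 the residue is (2N - 1) + (Y - y / Y) / (y - 1). As N > 0, the first summand is
     positive, and 1 < y <= Y makes the second nonnegative. *)
  pose y : R := expR 2; pose Y : R := expR (2 * N)%:R.
  have zp : z (2 * 1) = toC (1 - y^-1)^-1 by rewrite mulr1 -(rmorph_nat toC) z_real expRN.
  have zm : z (- (2 * 1)) = toC (1 - y)^-1.
    by rewrite mulr1 -(rmorph_nat toC) -rmorphN z_real opprK.
  have ep : expz N 1 = toC (Y^-1 * (1 - y^-1)^-1).
    rewrite /expz zp rmorphM; congr (_ * _).
    by rewrite mulr1 -(rmorph_nat toC) -rmorphN cexp_toC expRN.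
  have em : expz N (- 1) = toC (Y * (1 - y)^-1).
    rewrite /expz [2 * - 1]mulrN zm rmorphM; congr (_ * _).
    by rewrite mulrNN mulr1 -(rmorph_nat toC) cexp_toC.
  rewrite [2 * - 1]mulrN opprK zp zm ep em mulr1 -(rmorph_nat toC) -!(rmorphN, rmorphD) /=.
  rewrite -(rmorph0 toC) (inj_eq (@complexI R)).
  have y1 : 1 < y by rewrite /y expR_gt1.
  have yY : y <= Y by rewrite /Y /y ler_expR ler_nat leq_pmulr.
  have y0 : 0 < y by exact: lt_trans ltr01 y1.
  have Y1 : 1 <= Y by apply: le_trans yY; exact: ltW.
  have Y0 : 0 < Y by exact: lt_le_trans yY.
  have y10 : y - 1 != 0 by rewrite subr_eq0 gt_eqF.
  have -> : - (1 - y)^-1 + - (Y^-1 * (1 - y^-1)^-1) + (- (1 - y^-1)^-1 + - (Y * (1 - y)^-1)) +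
    (2 * N)%:R =
      ((2 * N)%:R - 1) + (Y - y / Y) / (y - 1).
    field; rewrite ?(gt_eqF y0) ?(gt_eqF Y0) ?y10 /=.
    by rewrite ?subr_eq0 ?(gt_eqF y1) ?(lt_eqF y1).
  rewrite gt_eqF// ltr_wpDr//.
    rewrite divr_ge0// subr_ge0; last exact: ltW.
    rewrite ler_pdivrMr//; apply: le_trans yY _.
    by rewrite ler_peMr// ltW.
  by rewrite subr_gt0 -(mulr1n 1) ltr_nat; case: N N_gt0 => // N' _; rewrite mulnS.
pose B' := B :\ k; have kB' : k \notin B' by rewrite !inE eqxx.
have BE : B = k |: B' by rewrite finset.setD1K.
have B'm : (#|B'| < m)%N by move: Bm; rewrite BE cardsU1 kB'.
have [a ga r0] := IH B' k B'm kB'.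
have jkB : j \notin k |: B' by rewrite -BE.
(* The three summands of the residue as functions of the [j]-th variable near [- a 0 k]: the first
   has the nonzero residue given by induction; the second meets the [k]-th variable at an equal
   argument and is regular; the third does not involve that variable. *)
have p1 := Jstar_pole_at_opp jkB kB' ga.
have p2 := simple_poleN (Jstar_pole_at_equal jkB kB' ga).
have p3 := holo_simple_pole (holo_cst (- a 0 k) ((2 * N)%:R * Jstar N (k |: B') a)).
have := simple_poleD (simple_poleD p1 p2) p3; rewrite oppr0 !addr0.
move=> /simple_pole_neq0 /(_ r0) h.
have [w [/= w1 w2]] := filter_ex (filterI h (near_generic_update j (- a 0 k) ga)).
exists (update a j w); first by rewrite BE.
rewrite BE /Jstar_residue update_update mxE eqxx.
suff -> : Jstar N (k |: B') (update a j w) = Jstar N (k |: B') a by [].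
rewrite !JstarE//; last exact: generic_out.
apply: eq_bigr => D DB; rewrite update_row Jterm_upd//.
  by apply: contra jkB; exact: (fintype.subsetP DB).
by rewrite inE (negbTE jkB) andbF.
Qed.

End JstarPoles.

Local Open Scope classical_set_scope.

Theorem theorem2p4 (R : realType) (N n : nat) (A : {set 'I_n}) (i j : 'I_n)
    (N_gt0 : (0 < N)%N) (iA : i \in A) (jA : j \in A) (neq_ij : i != j) :
  let A' := A :\: [set i; j] in
  [/\ (* at alpha^* = - beta^*: at most a simple pole, with the stated residue *)
      forall a : 'rV[C R]_n, generic (j |: A') a ->
        principal_part (fun w => Jstar N A (update a i w)) (- a 0 j)
          (Jstar_residue N A' j a *: 'X),
      (* the pole is genuine: the residue is not identically zero *)
      exists2 a : 'rV[C R]_n, generic (j |: A') a & Jstar_residue N A' j a != 0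
    & (* at alpha^* = 0: the poles cancel, the residue is zero *)
      forall a : 'rV[C R]_n, generic (j |: A') a ->
        principal_part (fun w => Jstar N A (update a i w)) 0 0].
Proof.
move=> A'; have jA' : j \notin A' by rewrite !inE eqxx orbT.
have iA' : i \notin j |: A' by rewrite !inE eqxx /= (negbTE neq_ij).
have AE : A = i |: (j |: A').
  apply/setP => k; rewrite !inE; have [->|_] := eqVneq k i; first by rewrite iA.
  by have [->|_] := eqVneq k j; rewrite ?jA.
split=> [a ga||a ga].
- by rewrite {1}AE; apply: simple_pole_principal_part; exact: Jstar_pole_at_opp.
- exact: Jstar_residue_neq0.
- rewrite AE -(scale0r 'X); apply: simple_pole_principal_part.
  exact: Jstar_pole_at0.
Qed.
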